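(* Let $E\subseteq\mathbb{R}^n$ be a set with positive reach and let $x_0\in\partial E$. For $\rho>0$ set $E_{x_0,\rho}=\frac{E-x_0}{\rho}$. Then the sets $E_{x_0,\rho}$ locally converge in measure, as $\rho\to0^+$, to $\mathrm{Tan}(E,x_0)$.
   Context: $n\ge2$. $\delta_E(x)=\inf_{y\in E}\|x-y\|$. $\mathrm{Unp}(E)$ is the set of $y\in\mathbb{R}^n$ for which there is a unique $x\in E$ with $\delta_E(y)=\|x-y\|$. For $x\in E$, $\mathrm{reach}(E,x)=\sup\{r>0: B_r(x)\subseteq\mathrm{Unp}(E)\}$, with $B_r(x)$ the open ball, and $\mathrm{reach}(E)=\inf_{x\in E}\mathrm{reach}(E,x)$. $E$ has positive reach if $\mathrm{reach}(E)>0$ (such a set is closed). For an accumulation point $x\in E$ of $E$, the tangent cone $\mathrm{Tan}(E,x)$ is the set of $\lambda v$ with $\lambda\ge0$ and $v=\lim_h\frac{x_h-x}{\|x_h-x\|}$ for some sequence $x_h\in E$, $x_h\ne x$, $x_h\to x$; if $x$ is isolated in $E$, $\mathrm{Tan}(E,x)=\{0\}$. A family of Borel sets $\{E_\rho\}_{\rho>0}$ locally converges in measure to $F$ as $\rho\to0^+$ if the characteristic functions $\mathbf{1}_{E_\rho}$ converge to $\mathbf{1}_F$ in $L^1_{\mathrm{loc}}(\mathbb{R}^n)$. *)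

(* Defs.v *)
From HB Require Import structures.
From mathcomp Require Import all_boot all_order all_algebra.
From mathcomp Require Import all_classical all_reals all_analysis.

Set Implicit Arguments.
Unset Strict Implicit.
Unset Printing Implicit Defensive.
Import Order.TTheory GRing.Theory Num.Theory.
Import numFieldNormedType.Exports.

Local Open Scope classical_set_scope.
Local Open Scope ring_scope.

(* The library's norm on ['rV[R]_n] is the sup norm; the topology of
   ['rV[R]_n] is the usual one of R^n, but metric notions must use [enorm]. *)
Definition enorm {R : realType} {n : nat} (x : 'rV[R]_n) : R :=
  Num.sqrt (\sum_(i < n) x 0 i ^+ 2).

Definition eball {R : realType} {n : nat} (x : 'rV[R]_n) (r : R) :
  set 'rV[R]_n := [set y | enorm (y - x) < r].

Definition boundary {T : topologicalType} (A : set T) : set T :=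
  closure A `\` interior A.

Definition dist_to {R : realType} {n : nat} (E : set 'rV[R]_n) (x : 'rV[R]_n) :
  R := inf [set enorm (x - y) | y in E].

Definition Unp {R : realType} {n : nat} (E : set 'rV[R]_n) : set 'rV[R]_n :=
  [set y | exists! x, E x /\ dist_to E y = enorm (x - y)].

(* Suprema of sets of positive radii are taken in [0, +oo], so that the
   supremum of the empty set is 0. *)
Definition reach_at {R : realType} {n : nat} (E : set 'rV[R]_n)
    (x : 'rV[R]_n) : \bar R :=
  maxe 0%E (ereal_sup [set r%:E | r in [set r | 0 < r /\ eball x r `<=` Unp E]]).

Definition reach {R : realType} {n : nat} (E : set 'rV[R]_n) : \bar R :=
  ereal_inf [set reach_at E x | x in E].

Definition positive_reach {R : realType} {n : nat} (E : set 'rV[R]_n) : Prop :=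
  (0 < reach E)%E.

Definition tangent_cone {R : realType} {n : nat} (E : set 'rV[R]_n)
    (x : 'rV[R]_n) : set 'rV[R]_n :=
  [set w | (limit_point E x /\
      exists (l : R) (v : 'rV[R]_n) (u : nat -> 'rV[R]_n),
        [/\ 0 <= l, w = l *: v, forall h, E (u h) /\ u h <> x,
            u @ \oo --> x &
            (fun h => (enorm (u h - x))^-1 *: (u h - x)) @ \oo --> v])
    \/ (isolated E x /\ w = 0)].

Definition blowup {R : realType} {n : nat} (E : set 'rV[R]_n)
    (x0 : 'rV[R]_n) (rho : R) : set 'rV[R]_n :=
  [set rho^-1 *: (x - x0) | x in E].

Definition box {R : realType} {n : nat} (c : 'rV[R]_n * 'rV[R]_n) :
  set 'rV[R]_n := [set x | forall i, c.1 0 i < x 0 i <= c.2 0 i].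

Definition box_vol {R : realType} {n : nat} (c : 'rV[R]_n * 'rV[R]_n) : R :=
  \prod_(i < n) (c.2 0 i - c.1 0 i).

(* Countable (possibly finite) coverings of [A] by boxes with ordered
   endpoints: the boxes [c k] for those indices [k] such that [P k]. *)
Definition box_cover {R : realType} {n : nat} (A : set 'rV[R]_n) :
    set (pred nat * (nat -> 'rV[R]_n * 'rV[R]_n)) :=
  [set Pc : pred nat * (nat -> 'rV[R]_n * 'rV[R]_n) |
            (forall k i, (Pc.2 k).1 0 i <= (Pc.2 k).2 0 i) /\
            A `<=` \bigcup_(k in [set k | Pc.1 k]) box (Pc.2 k)].

Definition lebesgue_outer (R : realType) (n : nat) (A : set 'rV[R]_n) :
    \bar R :=
  ereal_inf [set (\sum_(k <oo | Pc.1 k) (box_vol (Pc.2 k))%:E)%E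
            | Pc in box_cover A].

Section lebesgue_outer_measure.
Local Open Scope ereal_scope.
Context (R : realType) (n : nat).
Local Notation mu := (@lebesgue_outer R n).

Let vol_ge0 (A : set 'rV[R]_n)
    (Pc : pred nat * (nat -> 'rV[R]_n * 'rV[R]_n)) k :
  box_cover A Pc -> 0 <= (box_vol (Pc.2 k))%:E.
Proof.
by move=> [ab _]; rewrite lee_fin; apply: prodr_ge0 => i _; rewrite subr_ge0.
Qed.

Lemma lebesgue_outer_ge0 A : 0 <= mu A.
Proof.
apply: le_ereal_inf_tmp => _ [Pc cA <-].
by apply: nneseries_ge0 => k _ _; exact: vol_ge0 cA.
Qed.

Lemma lebesgue_outer0 : mu set0 = 0.
Proof.
apply/eqP; rewrite eq_le lebesgue_outer_ge0 andbT.
apply: ereal_inf_lbound; exists (xpred0, fun=> (0, 0)%R) => /=.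
  by split.
by rewrite eseries_pred0.
Qed.

Lemma le_lebesgue_outer : {homo mu : A B / A `<=` B >-> A <= B}.
Proof.
move=> A B AB; apply: ereal_inf_le_tmp => _ [Pc [ab cB] <-].
by exists Pc => //; split => //; exact: subset_trans cB.
Qed.

Lemma lebesgue_outer_sigma_subadditive : sigma_subadditive mu.
Proof.
move=> A; have [[i ioo]|] := pselect (exists i, mu (A i) = +oo).
  rewrite (eseries_pinfty _ _ ioo) ?leey// => k _.
  by rewrite -ltNye (lt_le_trans _ (lebesgue_outer_ge0 _)).
rewrite -forallNE => Aoo.
apply/lee_addgt0Pr => e e0.
rewrite (le_trans _ (epsilon_trick _ _ (ltW e0)))//; last first.
  by move=> k; exact: lebesgue_outer_ge0.
have /choice[G PG] : forall i,
    exists Pc : pred nat * (nat -> 'rV[R]_n * 'rV[R]_n), box_cover (A i) Pc /\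
    \sum_(k <oo | Pc.1 k) (box_vol (Pc.2 k))%:E <=
    mu (A i) + (e / (2 ^ i.+1)%:R)%:E.
  move=> i; have fA : mu (A i) \is a fin_num.
    by rewrite ge0_fin_numE ?lebesgue_outer_ge0// ltey; apply/eqP/Aoo.
  have ei : (0 < e / (2 ^ i.+1)%:R)%R by rewrite divr_gt0// ltr0n expn_gt0.
  have [_ [Pc cA <-] /ltW le_e] := lb_ereal_inf_adherent ei fA.
  by exists Pc.
have /card_esym/ppcard_eqP[f] := card_nat2.
pose v (ij : nat * nat) : \bar R :=
  if (G ij.1).1 ij.2 then (box_vol ((G ij.1).2 ij.2))%:E else 0.
have v_ge0 ij : 0 <= v ij.
  by rewrite /v; case: ifPn => // _; exact: vol_ge0 (PG _).1.
apply: (@le_trans _ _ (\esum_(ij in setT) v ij)).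
  apply: ereal_inf_lbound; exists
    ((fun k => (G (f k).1).1 (f k).2), (fun k => (G (f k).1).2 (f k).2)) => /=.
    split=> [k i|x [i _ Aix]]; first exact: (PG _).1.1.
    have [j Pj xj] := (PG i).1.2 _ Aix.
    by exists (f^-1%FUN (i, j)) => /=; rewrite invK ?inE.
  rewrite eseries_mkcond -(esum_pred_image v f xpredT) ?[fun=> _]set_true//.
  by rewrite image_eq.
rewrite (_ : esum _ _ = \sum_(i <oo) \sum_(j <oo) v (i, j)); last first.
  pose J : nat -> set (nat * nat) := fun i => [set (i, j) | j in setT].
  rewrite (_ : setT = \bigcup_k J k); last first.
    by rewrite predeqE => -[a b]; split => // _; exists a => //; exists b.
  rewrite esum_bigcupT //=; last first.
    apply/trivIsetP => i j _ _ ij.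
    rewrite predeqE => -[k m] /=; split => //= -[] [_] _ [<-{k} _].
    by move=> [m' _] [] /esym/eqP; rewrite (negbTE ij).
  rewrite -(image_id [set: nat]) -fun_true esum_pred_image//; last first.
    by move=> k _; exact: esum_ge0.
  apply: eq_eseriesr => /= j _.
  rewrite -(esum_pred_image v (pair j) predT)//=; last first.
    by move=> ? ? _ _; exact: (@can_inj _ _ _ snd).
  by congr esum; rewrite predeqE => -[a b]; split; move=> [i _ <-]; exists i.
apply: lee_nneseries => [i _ _|i _]; first by apply: nneseries_ge0.
by rewrite -eseries_mkcond; exact: (PG i).2.
Qed.

HB.instance Definition _ := isOuterMeasure.Build R 'rV[R]_n
  (@lebesgue_outer R n) lebesgue_outer0 lebesgue_outer_ge0
  le_lebesgue_outer lebesgue_outer_sigma_subadditive.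

End lebesgue_outer_measure.

(* R^n with the sigma-algebra of its Lebesgue measurable sets, i.e. the sets
   that are Caratheodory measurable for the outer measure. *)
Definition Rn (R : realType) (n : nat) : measurableType _ :=
  caratheodory_type (@lebesgue_outer R n).

Definition Rn_lebesgue (R : realType) (n : nat) : set (Rn R n) -> \bar R :=
  @lebesgue_outer R n.

Section Rn_lebesgue_measure.
Context (R : realType) (n : nat).

Let measure0 : Rn_lebesgue (set0 : set (Rn R n)) = 0%E.
Proof. exact: lebesgue_outer0. Qed.

Let measure_ge0 (A : set (Rn R n)) : (0 <= Rn_lebesgue A)%E.
Proof. exact: lebesgue_outer_ge0. Qed.

Let measure_semi_sigma_additive : semi_sigma_additive (@Rn_lebesgue R n).
Proof.
by move=> F mF tF mUF; exact: caratheodory_measure_sigma_additive.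
Qed.

HB.instance Definition _ := isMeasure.Build _ _ _ (@Rn_lebesgue R n)
  measure0 measure_ge0 measure_semi_sigma_additive.

End Rn_lebesgue_measure.

Definition borel {T : topologicalType} (A : set T) : Prop :=
  <<s [set U : set T | open U] >> A.

Definition L1_loc {R : realType} {n : nat} (f : 'rV[R]_n -> R) : Prop :=
  forall K : set 'rV[R]_n, compact K ->
    (@Rn_lebesgue R n).-integrable K (EFin \o f).

Definition cvg_L1_loc {R : realType} {n : nat} (f : R -> 'rV[R]_n -> R)
    (g : 'rV[R]_n -> R) : Prop :=
  [/\ forall rho, 0 < rho -> L1_loc (f rho), L1_loc g &
      forall K : set 'rV[R]_n, compact K ->
        (\int[@Rn_lebesgue R n]_(x in K) `|f rho x - g x|%:E)%E
          @[rho --> 0^'+] --> 0%E].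

Definition locally_cvg_in_measure {R : realType} {n : nat}
    (E : R -> set 'rV[R]_n) (F : set 'rV[R]_n) : Prop :=
  (forall rho, 0 < rho -> borel (E rho)) /\
  cvg_L1_loc (fun rho => \1_(E rho)) \1_F.

(* Main.v *)
Require Import Defs.
From mathcomp Require Import all_boot all_order all_algebra.
From mathcomp Require Import all_classical all_reals all_analysis.
From mathcomp Require Import measurable_realfun lra.
Import Order.TTheory GRing.Theory Num.Theory.
Import numFieldNormedType.Exports.
Local Open Scope classical_set_scope.
Local Open Scope ring_scope.

Set Implicit Arguments.
Unset Strict Implicit.
Unset Printing Implicit Defensive.

(* Uniqueness of nearest points makes the distance function to [E] have slope 1
   near [E]; hence one can climb away from [E] at full speed, so that [E] is
   touched from outside, at the nearest point [p] of any nearby [y], by a ball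
   of fixed radius. This gives Federer's
   inequality [<a - p, y - p> <= c |a - p|^2 |y - p|] for [a] in [E]. It implies
   that segments between points of [E] of length [l] stay at distance [O(l^2)]
   from [E], so that [T = Tan(E, x0)] is a closed convex cone whose vectors are
   approximated by the blow-ups at all small scales. A vector outside [T]
   eventually leaves the blow-ups by definition; an interior vector of [T]
   eventually belongs to them, since otherwise the touching balls would converge
   to a supporting half-space of [T] at that vector. Finally the boundary of [T]
   is null because it has infinitely many disjoint translates, and dominated
   convergence concludes. *)

(** * The Euclidean norm *)

Section euclidean.
Context {R : realType} {n : nat}.
Implicit Types (x y z : 'rV[R]_n) (a : R).

Definition dot x y : R := \sum_(i < n) x 0 i * y 0 i.

Lemma dotC x y : dot x y = dot y x.
Proof. by apply: eq_bigr => i _; rewrite mulrC. Qed.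

Lemma dotDl x y z : dot (x + y) z = dot x z + dot y z.
Proof. by rewrite -big_split; apply: eq_bigr => i _; rewrite mxE mulrDl. Qed.

Lemma dotZl a x y : dot (a *: x) y = a * dot x y.
Proof. by rewrite mulr_sumr; apply: eq_bigr => i _; rewrite mxE mulrA. Qed.

Lemma dotNl x y : dot (- x) y = - dot x y.
Proof. by rewrite -scaleN1r dotZl mulN1r. Qed.

Lemma dotDr x y z : dot z (x + y) = dot z x + dot z y.
Proof. by rewrite dotC dotDl !(dotC z). Qed.

Lemma dotZr a x y : dot y (a *: x) = a * dot y x.
Proof. by rewrite dotC dotZl dotC. Qed.

Lemma dotNr x y : dot y (- x) = - dot y x.
Proof. by rewrite dotC dotNl dotC. Qed.

Definition dotE := (dotDl, dotDr, dotNl, dotNr, dotZl, dotZr).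

Lemma dot_ge0 x : 0 <= dot x x.
Proof. by apply: sumr_ge0 => i _; rewrite -expr2 sqr_ge0. Qed.

Lemma sqr_enorm x : enorm x ^+ 2 = dot x x.
Proof.
rewrite /enorm sqr_sqrtr; first by apply: eq_bigr => i _; rewrite expr2.
by apply: sumr_ge0 => i _; rewrite sqr_ge0.
Qed.

Lemma enorm_ge0 x : 0 <= enorm x.
Proof. exact: sqrtr_ge0. Qed.

Lemma enormZ a x : enorm (a *: x) = `|a| * enorm x.
Proof.
apply/eqP; rewrite -(@eqrXn2 _ 2) ?mulr_ge0 ?enorm_ge0//.
by rewrite exprMn !sqr_enorm !dotE mulrA -expr2 real_normK ?num_real.
Qed.

Lemma enorm0 : enorm (0 : 'rV[R]_n) = 0.
Proof. by rewrite -(scale0r 0) enormZ normr0 mul0r. Qed.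

Lemma enormN x : enorm (- x) = enorm x.
Proof. by rewrite -scaleN1r enormZ normrN1 mul1r. Qed.

Lemma enormBC x y : enorm (x - y) = enorm (y - x).
Proof. by rewrite -enormN opprB. Qed.

Lemma coord_le_enorm x i : `|x 0 i| <= enorm x.
Proof.
rewrite -(@ler_pXn2r _ 2) ?nnegrE ?enorm_ge0// sqr_enorm real_normK ?num_real//.
rewrite /dot (bigD1 i)//= -expr2 lerDl.
by apply: sumr_ge0 => j _; rewrite -expr2 sqr_ge0.
Qed.

Lemma enorm_eq0 x : (enorm x == 0) = (x == 0).
Proof.
apply/idP/eqP => [/eqP x0|->]; last by rewrite enorm0.
apply/rowP => i; rewrite mxE; apply/normr0_eq0/eqP.
by rewrite eq_le normr_ge0 -x0 coord_le_enorm.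
Qed.

Lemma enorm_gt0 x : (0 < enorm x) = (x != 0).
Proof. by rewrite lt_def enorm_ge0 andbT enorm_eq0. Qed.

Lemma cauchy_schwarz x y : dot x y <= enorm x * enorm y.
Proof.
have [->|x0] := eqVneq x 0.
  by rewrite enorm0 mul0r -(scale0r 0) dotZl mul0r.
have [->|y0] := eqVneq y 0.
  by rewrite enorm0 mulr0 -(scale0r 0) dotZr mul0r.
have xy0 : 0 < enorm x * enorm y by rewrite mulr_gt0 ?enorm_gt0.
have := dot_ge0 (enorm y *: x - enorm x *: y).
rewrite !dotE (dotC y x) -!sqr_enorm => H.
rewrite -(ler_pM2l xy0); nra.
Qed.

Lemma enormD x y : enorm (x + y) <= enorm x + enorm y.
Proof.
rewrite -(@ler_pXn2r _ 2) ?nnegrE ?addr_ge0 ?enorm_ge0//.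
rewrite sqrrD !sqr_enorm !dotE (dotC y x) mulr2n.
have := cauchy_schwarz x y; lra.
Qed.

Lemma enorm_triangle y x z : enorm (x - z) <= enorm (x - y) + enorm (y - z).
Proof. by have := enormD (x - y) (y - z); rewrite addrA subrK. Qed.

Lemma norm_le_enorm x : `|x| <= enorm x.
Proof.
rewrite /Num.norm /= mx_normrE; apply/bigmax_leP; split; first exact: enorm_ge0.
by move=> [i j] _ /=; rewrite (ord1 i) coord_le_enorm.
Qed.

Lemma coord_le_norm x i : `|x 0 i| <= `|x|.
Proof.
by rewrite [leRHS]/Num.norm /= mx_normrE; apply/bigmax_geP; right; exists (0, i).
Qed.

Lemma enorm_le_norm x : enorm x <= n%:R * `|x|.
Proof.
rewrite -(@ler_pXn2r _ 2) ?nnegrE ?mulr_ge0 ?enorm_ge0//.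
rewrite sqr_enorm exprMn.
have -> : n%:R ^+ 2 * `|x| ^+ 2 = \sum_(i < n) n%:R * `|x| ^+ 2.
  by rewrite sumr_const card_ord -[in LHS]mulrA mulr_natl.
apply: ler_sum => i _; rewrite -expr2 -(real_normK (num_real _)).
(* The index [i] excludes [n = 0]. *)
have n1 : 1 <= n%:R :> R by rewrite ler1n; case: n i => [[]|].
apply: le_trans (_ : `|x| ^+ 2 <= _).
  by rewrite ler_pXn2r ?nnegrE ?coord_le_norm.
by rewrite ler_peMl// sqr_ge0.
Qed.

Lemma nbhs_enormP x (A : set 'rV[R]_n) :
  nbhs x A <-> exists2 e : R, 0 < e & eball x e `<=` A.
Proof.
split=> [/nbhs_ballP[e /= e0 xA]|[e e0 xA]].
  exists e => // y xy; apply: xA.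
  by rewrite -ball_normE /= distrC (le_lt_trans (norm_le_enorm _)).
(* [n.+1] replaces [n] as comparison constant so that the radius below is positive also in dimension
   0. *)
have n0 : 0 < n.+1%:R :> R by [].
apply/nbhs_ballP; exists (e / n.+1%:R); first exact: divr_gt0.
move=> y; rewrite -ball_normE /= distrC => xy; apply: xA.
rewrite /eball /= (le_lt_trans (enorm_le_norm _))//.
move: xy; rewrite ltr_pdivlMr// => /(le_lt_trans _); apply.
by rewrite mulrC ler_wpM2l// ler_nat.
Qed.

Lemma lipschitz1_continuous (f : 'rV[R]_n -> R) :
  (forall x y, f x <= f y + enorm (x - y)) -> continuous f.
Proof.
move=> fL x; apply/(@cvgrPdist_lt _ _ _ (nbhs x)) => e e0.
apply/nbhs_enormP; exists e => // y xy /=.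
rewrite ltr_norml.
have := fL x y; have := fL y x; rewrite enormBC.
move: xy; rewrite /eball/= enormBC; lra.
Qed.

Lemma enormB_continuous y : continuous (fun x => enorm (x - y)).
Proof.
by apply: lipschitz1_continuous => x z; rewrite [leRHS]addrC; exact: enorm_triangle.
Qed.

Lemma closed_enormP (A : set 'rV[R]_n) : closed A <->
  forall x, (forall e, 0 < e -> exists2 y, A y & enorm (y - x) < e) -> A x.
Proof.
split=> [cA x xA|xA x cAx].
  apply: cA => B /nbhs_enormP[e e0 xB].
  by have [y Ay xy] := xA e e0; exists y; split => //; exact: xB.
apply: xA => e e0.
have [|y [Ay xy]] := cAx (eball x e); first by apply/nbhs_enormP; exists e.
by exists y.
Qed.

Lemma compact_enorm (A : set 'rV[R]_n) x r :
  closed A -> (forall y, A y -> enorm (y - x) <= r) -> compact A.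
Proof.
move=> cA Ar; apply: bounded_closed_compact => //.
exists (r + enorm x); split => [|s rs y Ay]; first exact: num_real.
apply: le_trans (ltW rs); apply: le_trans (norm_le_enorm _) _.
by rewrite -[y in leLHS](subrK x) (le_trans (enormD _ _))// lerD2r Ar.
Qed.

Lemma cvg_enorm (u : nat -> 'rV[R]_n) (v : 'rV[R]_n) :
  (forall k, enorm (u k - v) < k.+1%:R^-1) -> u @ \oo --> v.
Proof.
move=> uv U /nbhs_enormP[e e0 vU].
apply: filterS (near_infty_natSinv_lt (PosNum e0)) => k ke.
by apply: vU; exact: lt_trans (uv k) ke.
Qed.

Lemma compact_enorm_lt (K : set 'rV[R]_n) : compact K ->
  exists r : R, forall x, K x -> enorm x < r.
Proof.
move=> /compact_bounded/ex_strict_bound_gt0[r r0 Kr].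
exists (n.+1%:R * r) => x Kx; rewrite (le_lt_trans (enorm_le_norm x))//.
apply: (@le_lt_trans _ _ (n.+1%:R * `|x|)); first by rewrite ler_wpM2r// ler_nat.
by rewrite ltr_pM2l// Kr.
Qed.

End euclidean.

(** * Lebesgue measure *)

Section lebesgue.
Context {R : realType} {n : nat}.
Implicit Types (A : set 'rV[R]_n) (x v : 'rV[R]_n).
Local Notation mu := (@lebesgue_outer R n).

(** Changing one coordinate of a corner cuts a box along a coordinate hyperplane. *)
Definition set_coord (i : 'I_n) (m : R) v : 'rV[R]_n :=
  \row_j (if j == i then m else v 0 j).

Lemma box_vol_split (a b : 'rV[R]_n) i (m : R) :
  box_vol (a, set_coord i m b) + box_vol (set_coord i m a, b) = box_vol (a, b).
Proof.
rewrite /box_vol (bigD1 i)//= [X in _ + X](bigD1 i)//= [RHS](bigD1 i)//= !mxE eqxx.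
rewrite (eq_bigr (fun j => b 0 j - a 0 j)); last first.
  by move=> j /negbTE ji; rewrite mxE ji.
rewrite [X in _ + _ * X](eq_bigr (fun j => b 0 j - a 0 j)); last first.
  by move=> j /negbTE ji; rewrite mxE ji.
by rewrite -mulrDl addrC addrA subrK.
Qed.

Lemma box_vol_ge0 (c : 'rV[R]_n * 'rV[R]_n) :
  (forall i, c.1 0 i <= c.2 0 i) -> 0 <= box_vol c.
Proof. by move=> c12; apply: prodr_ge0 => i _; rewrite subr_ge0. Qed.

(** The hyperplane cuts every box of a cover of [X] into two boxes whose volumes add up, so the
    cover splits into covers of the two pieces of [X] at no extra cost. *)
Lemma halfspace_measurable (i : 'I_n) (c : R) :
  measurable ([set x | x 0 i <= c] : set (Rn R n)).
Proof.
apply: le_caratheodory_measurable => X.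
apply: le_ereal_inf_tmp => _ [[P b] [/= ab Xb] <-].
(* The level [c] is clamped to the [i]-th side of the box, so that both halves keep ordered
   endpoints even if the hyperplane misses the box. *)
pose m k := Num.max ((b k).1 0 i) (Num.min ((b k).2 0 i) c).
have m_ge k : (b k).1 0 i <= m k by rewrite le_max lexx.
have m_le k : m k <= (b k).2 0 i by rewrite ge_max ab ge_min lexx.
pose b1 k := ((b k).1, set_coord i (m k) (b k).2).
pose b2 k := (set_coord i (m k) (b k).1, (b k).2).
have ab1 k j : (b1 k).1 0 j <= (b1 k).2 0 j.
  by rewrite mxE; case: eqP => [->|_]; [exact: m_ge|exact: ab].
have ab2 k j : (b2 k).1 0 j <= (b2 k).2 0 j.
  by rewrite mxE; case: eqP => [->|_]; [exact: m_le|exact: ab].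
apply: (@le_trans _ _ (\sum_(k <oo | P k) (box_vol (b1 k))%:E +
    \sum_(k <oo | P k) (box_vol (b2 k))%:E)%E); last first.
  rewrite -nneseriesD; last 2 first.
  - by move=> k _ _; rewrite lee_fin box_vol_ge0//; exact: ab1.
  - by move=> k _ _; rewrite lee_fin box_vol_ge0//; exact: ab2.
  rewrite (eq_eseriesr (g := fun k => (box_vol (b k))%:E))// => k _.
  by rewrite -EFinD box_vol_split -surjective_pairing.
apply: leeD; apply: ereal_inf_lbound.
- exists (P, b1) => //; split=> // x [Xx xc].
  have [k Pk xb] := Xb x Xx; exists k => // j /=; rewrite mxE.
  case: eqP => [->|_]; last exact: xb.
  have /andP[ax bx] := xb i.
  by rewrite ax /m le_max le_min bx xc orbT.
- exists (P, b2) => //; split=> // x [Xx /= /negP].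
  rewrite -ltNge => cx.
  have [k Pk xb] := Xb x Xx; exists k => // j /=; rewrite mxE.
  case: eqP => [->|_]; last exact: xb.
  have /andP[ax bx] := xb i.
  by rewrite bx /m gt_max gt_min ax cx orbT.
Qed.

Lemma box_measurable (c : 'rV[R]_n * 'rV[R]_n) :
  measurable (box c : set (Rn R n)).
Proof.
rewrite (_ : box c = \bigcap_(i in [set: 'I_n])
  (~` [set x : 'rV[R]_n | x 0 i <= c.1 0 i] `&` [set x | x 0 i <= c.2 0 i])).
  apply: fin_bigcap_measurable => // i _.
  apply: measurableI; last exact: halfspace_measurable.
  exact/measurableC/halfspace_measurable.
apply/seteqP; split => x xc i => [_|].
  by have /andP[? ?] := xc i; split => //=; apply/negP; rewrite -ltNge.
by have [/negP + ->] := xc i I; rewrite -ltNge => ->.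
Qed.

(** An open set is the union of the boxes with rational corners that it contains, of which there are
    countably many. *)
Lemma open_measurable_Rn A : open A -> measurable (A : set (Rn R n)).
Proof.
move=> oA.
pose B (q : 'rV[rat]_n * 'rV[rat]_n) : set 'rV[R]_n :=
  box (map_mx ratr q.1, map_mx ratr q.2).
rewrite (_ : A = \bigcup_q (if pselect (B q `<=` A) then B q else set0)).
  apply: countable_bigcupT_measurable; first exact: countableP.
  by move=> q; case: pselect => ? /=; [exact: box_measurable|exact: measurable0].
apply/seteqP; split => [x Ax|x [q _]]; last by case: pselect => [BA|//]; exact: BA.
have /nbhs_ballP[e /= e0 xA] : nbhs x A by exact: open_nbhs_nbhs.
have /choice[q1 q1P] : forall i, exists q : rat, x 0 i - e / 2 < ratr q < x 0 i.
  move=> i; have [|q] := @rat_in_itvoo _ (x 0 i - e / 2) (x 0 i); first lra.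
  by rewrite in_itv/=; exists q.
have /choice[q2 q2P] : forall i, exists q : rat, x 0 i < ratr q < x 0 i + e / 2.
  move=> i; have [|q] := @rat_in_itvoo _ (x 0 i) (x 0 i + e / 2); first lra.
  by rewrite in_itv/=; exists q.
exists (\row_i q1 i, \row_i q2 i) => //; case: pselect => [_ i|].
  rewrite !mxE; have := q1P i; have := q2P i; lra.
move=> nA; exfalso; apply: nA => y yB; apply: xA.
rewrite -ball_normE /= [ltLHS]/Num.norm /= mx_normrE; apply/bigmax_ltP; split => //.
move=> [j i] _ /=; rewrite (ord1 j) !mxE ltr_norml.
have := yB i; rewrite !mxE; have := q1P i; have := q2P i; lra.
Qed.

Lemma closed_measurable_Rn A : closed A -> measurable (A : set (Rn R n)).
Proof.
by move=> cA; rewrite -[A]setCK; apply/measurableC/open_measurable_Rn/closed_openC.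
Qed.

Lemma lebesgue_outer_translate_le A v :
  (mu [set (x + v)%R | x in A] <= mu A)%E.
Proof.
apply: le_ereal_inf_tmp => _ [[P b] [/= ab Ab] <-].
apply: ereal_inf_lbound; exists (P, fun k => ((b k).1 + v, (b k).2 + v)) => /=.
  split => [k i|_ [x Ax <-]] /=; first by rewrite !mxE lerD2r.
  have [k Pk xb] := Ab x Ax; exists k => // i /=.
  by rewrite !mxE ltrD2r lerD2r; exact: xb.
apply: eq_eseriesr => k _; congr EFin; apply: eq_bigr => i _ /=.
by rewrite !mxE opprD addrACA subrr addr0.
Qed.

Lemma lebesgue_outer_translate A v : mu [set (x + v)%R | x in A] = mu A.
Proof.
apply/eqP; rewrite eq_le lebesgue_outer_translate_le /=.
have AE : [set x - v | x in [set x + v | x in A]] = A.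
  rewrite image_comp -[RHS]image_id.
  by apply: eq_imagel => x _ /=; rewrite addrK.
by rewrite -{1}AE; exact: lebesgue_outer_translate_le.
Qed.

(** By translation invariance, testing the translate of [A] on [X] amounts to testing [A] on
    [X - v]. *)
Lemma translate_measurable A v : measurable (A : set (Rn R n)) ->
  measurable ([set x + v | x in A] : set (Rn R n)).
Proof.
have tE (B : set 'rV[R]_n) w : [set x + w | x in B] = [set x | B (x - w)].
  apply/seteqP; split => [_ [x Bx <-]|x Bx] /=; first by rewrite addrK.
  by exists (x - w); rewrite ?subrK.
move=> mA; apply: le_caratheodory_measurable => X.
have {}mA Y : mu Y = (mu (Y `&` A) + mu (Y `&` ~` A))%E by exact: mA.
rewrite tE.
change (mu (X `&` [set x | A (x - v)%R]) + mu (X `&` ~` [set x | A (x - v)%R]) <=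
  mu X)%E.
rewrite -(lebesgue_outer_translate X (- v)) (mA [set x - v | x in X])%R tE opprK.
set Y := [set x | X (x + v)%R].
rewrite -(lebesgue_outer_translate (Y `&` A) v).
rewrite -(lebesgue_outer_translate (Y `&` ~` A) v) !tE.
by apply: leeD; apply: le_lebesgue_outer => x [Xx Ax]; split;
  rewrite /Y /= ?subrK.
Qed.

Lemma bounded_lebesgue_outer_lty A (r : R) :
  (forall x, A x -> enorm x < r) -> (mu A < +oo)%E.
Proof.
move=> Ar; pose c : 'rV[R]_n * 'rV[R]_n := (const_mx (- `|r|), const_mx `|r|).
apply: (@le_lt_trans _ _ (\sum_(k <oo | k == 0%N) (box_vol c)%:E)%E).
  apply: ereal_inf_lbound; exists ((fun k => k == 0%N), (fun=> c)) => //; split => /=.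
    by move=> _ i; rewrite !mxE; have := normr_ge0 r; lra.
  move=> x Ax; exists 0%N => //= i; rewrite !mxE.
  have := coord_le_enorm x i; have := Ar x Ax; have := ler_norm r.
  rewrite ler_norml; lra.
have c0 : (0 <= (box_vol c)%:E)%E.
  by rewrite lee_fin box_vol_ge0// => i; rewrite !mxE; have := normr_ge0 r; lra.
rewrite (nneseriesD1 (n := 0%N))// eseries_pred0 ?adde0 ?ltry// => k.
by rewrite andbN.
Qed.

(* The sets [A + e / k] are disjoint, of equal measure, and contained in one
   ball. *)
Lemma null_of_disjoint_translates A (e : 'rV[R]_n) (r : R) :
  measurable (A : set (Rn R n)) -> (forall x, A x -> enorm x < r) ->
  (forall x y (t : R), A x -> A y -> 0 < t -> y <> x + t *: e) ->
  mu A = 0%E.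
Proof.
move=> mA Ar Ae.
pose F k : set (Rn R n) := [set x + k.+1%:R^-1 *: e | x in A].
have mF k : measurable (F k) by exact: translate_measurable.
have tF : trivIset setT F.
  apply: ltn_trivIset => k l lk.
  apply/disjoints_subset => _ [x Ax <-] [y Ay] yx.
  apply: (Ae x y (l.+1%:R^-1 - k.+1%:R^-1) Ax Ay).
    by rewrite subr_gt0 ltf_pV2 ?posrE// ltr_nat.
  by rewrite scalerBl addrA -yx addrK.
have Fb x : (\bigcup_k F k) x -> enorm x < r + enorm e.
  move=> [k _ [y Ay <-]]; rewrite (le_lt_trans (enormD _ _))// ltr_leD ?Ar//.
  rewrite enormZ ler_piMl ?enorm_ge0// gtr0_norm// invf_le1//.
  by rewrite ler1n.
have FE : mu (\bigcup_k F k) = (\sum_(k <oo) mu (F k))%E.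
  apply: eq_trans
    (@measure_bigcup _ _ _ (@Rn_lebesgue R n) setT F (fun k _ => mF k) tF) _.
  by apply: eq_eseriesl => k; rewrite in_setT.
have := bounded_lebesgue_outer_lty Fb; rewrite FE.
rewrite (eq_eseriesr (g := fun=> mu A)); last first.
  by move=> k _; exact: lebesgue_outer_translate.
have muA0 := lebesgue_outer_ge0 A.
have := @nneseries_lim_ge R (fun=> mu A) xpredT 0 _ (fun _ _ _ => muA0).
move: muA0; case: (mu A) => [m|_ /(_ 1%N)|//]; last first.
  by rewrite big_nat1 leye_eq => /eqP ->.
rewrite lee_fin le_eqVlt => /predU1P[<-//|m0] mS.
set S := (X in (X < +oo)%E).
have S0 : (0 <= S)%E by rewrite (le_trans _ (mS 0%N))// big_nil.
move: S0 mS; rewrite -/S; case: S => [S|//|//]; rewrite lee_fin => S0 mS _.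
(* If [mu A = m > 0], more than [S / m] copies of [A] would exceed the finite total [S]. *)
have := mS (Num.bound (S / m)); rewrite sumEFin lee_fin sumr_const_nat subn0.
rewrite leNgt -mulr_natl -ltr_pdivrMr//.
by rewrite archi_boundP// divr_ge0// ltW.
Qed.

End lebesgue.

(** * Nearest points *)

Section distance.
Context {R : realType} {n : nat} (E : set 'rV[R]_n).
Hypothesis E0 : E !=set0.
Implicit Types (x y z p a : 'rV[R]_n).

Lemma dist_to_le a x : E a -> dist_to E x <= enorm (x - a).
Proof.
move=> Ea; apply: ge_inf; last by exists a.
by exists 0 => _ [b _ <-]; exact: enorm_ge0.
Qed.

Lemma le_dist_to x (d : R) :
  (forall a, E a -> d <= enorm (x - a)) -> d <= dist_to E x.
Proof.
have [a Ea] := E0; move=> dE; apply: lb_le_inf; first by exists (enorm (x - a)), a.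
by move=> _ [b Eb <-]; exact: dE.
Qed.

Lemma dist_to_lipschitz x y : dist_to E x <= dist_to E y + enorm (x - y).
Proof.
rewrite -lerBlDr; apply: le_dist_to => a Ea.
rewrite lerBlDr addrC (le_trans (dist_to_le x Ea))//.
exact: enorm_triangle.
Qed.

Lemma dist_to_continuous : continuous (dist_to E).
Proof. exact/lipschitz1_continuous/dist_to_lipschitz. Qed.

(** * Growth of the distance where nearest points are unique *)

Section tube.
Variable r : R.
Hypothesis UnpE : forall y, dist_to E y < r -> Unp E y.
Hypothesis r0 : 0 < r.

(** A point of the closure has distance 0 to [E], hence lies in [Unp E] and coincides with its
    nearest point. *)
Lemma unp_closed : closed E.
Proof.
apply/closed_enormP => x xE.
have dx0 : dist_to E x = 0.
  apply/eqP; rewrite eq_le le_dist_to; last by move=> *; exact: enorm_ge0.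
  rewrite andbT; apply/ler_addgt0Pl => e e0; rewrite addr0.
  have [y Ey xy] := xE e e0.
  by rewrite (le_trans (dist_to_le x Ey))// enormBC ltW.
have [|p [[Ep]]] := UnpE (y := x); first by rewrite dx0.
rewrite dx0 => /esym/eqP; rewrite enorm_eq0 subr_eq0 => /eqP px _.
by rewrite -px.
Qed.

(* Points of [E] that are almost nearest to [z] are close to its unique
   nearest point [p], by compactness; hence moving [z] away from [p] increases
   the distance to [E] at rate 1. *)
Lemma dist_to_ascent z (s : R) : 0 < dist_to E z < r -> 0 <= s < 1 ->
  exists2 t0 : R, 0 < t0 & forall t, 0 < t < t0 -> exists z',
    enorm (z' - z) <= t /\ dist_to E z + s * t <= dist_to E z'.
Proof.
move=> /andP[d0 dr] /andP[s0 s1].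
have [p [[Ep pd] pU]] := UnpE dr.
set d := dist_to E z in d0 dr pd pU *.
pose nu := d^-1 *: (z - p).
have nu1 : dot nu nu = 1.
  by rewrite dotZl dotZr -sqr_enorm enormBC -pd expr2 mulKf ?mulVf// gt_eqF.
have nu1' : enorm nu = 1.
  by apply/eqP; rewrite -(@eqrXn2 _ 2) ?enorm_ge0// sqr_enorm nu1 expr1n.
have nup : dot nu (z - p) = d.
  by rewrite dotZl -sqr_enorm enormBC -pd expr2 mulKf// gt_eqF.
clearbody nu.
(* The points of [E] that could spoil an ascent of slope [s] in the direction [nu]. This compact set
   misses [p] because [s < 1], so its distance to [z] exceeds [d] by some [eta]. *)
pose C := [set w | E w /\ enorm (w - z) <= d + 1 /\ dot nu (z - w) <= s * d].
have cC : compact C.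
  apply: (@compact_enorm _ _ _ z (d + 1)); last by move=> y [_ []].
  apply/closed_enormP => x xC; split.
    apply: (closed_enormP E).1; first exact: unp_closed.
    by move=> e /xC[y [Ey _] xy]; exists y.
  split.
    apply/ler_addgt0Pl => e e0; have [y [_ [yd _]] xy] := xC e e0.
    have := enorm_triangle y x z; rewrite (enormBC x y); lra.
  apply/ler_addgt0Pl => e e0; have [y [_ [_ yd]] xy] := xC e e0.
  have -> : z - x = (z - y) + (y - x) by rewrite addrA subrK.
  by rewrite dotDr; have := cauchy_schwarz nu (y - x); rewrite nu1'; lra.
have [eta eta0 Ceta] : exists2 eta : R, 0 < eta &
    forall w, C w -> d + eta <= enorm (w - z).
  have [->|/set0P C0] := eqVneq C set0; first by exists 1.
  have [w] := compact_EVT_min C0 cC (continuous_subspaceT (@enormB_continuous _ _ z)).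
  rewrite inE => -[Ew [wz wd]] wmin.
  exists (enorm (w - z) - d); last by move=> v Cv; rewrite addrC subrK wmin ?inE.
  rewrite subr_gt0 lt_neqAle enormBC dist_to_le// andbT.
  apply/eqP => dw; have pw : p = w by apply: pU; rewrite -enormBC.
  by move: wd; rewrite -pw nup; nra.
(* A point of [E] within [d + t] of the moved point is within [d + 2 * t] of [z]; this must stay
   below both [d + eta] and [d + 1] to exclude membership in [C]. *)
exists (Num.min (eta / 2) (1 / 2)).
  by rewrite lt_min; apply/andP; split; lra.
move=> t /andP[t0]; rewrite lt_min => /andP[te t1].
exists (z + t *: nu); split.
  rewrite addrC addKr enormZ gtr0_norm//.
  by rewrite nu1' mulr1.
apply: le_dist_to => a Ea.
have st : s * t <= t by rewrite ler_piMl// ltW.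
have [adt|adt] := leP (d + t) (enorm (z + t *: nu - a)); first lra.
have azd : enorm (a - z) < d + 2 * t.
  rewrite enormBC.
  have -> : z - a = (z + t *: nu - a) + (- t) *: nu.
    by rewrite addrAC scaleNr addrK.
  rewrite (le_lt_trans (enormD _ _))// enormZ.
  rewrite nu1' normrN gtr0_norm//; lra.
have nua : s * d < dot nu (z - a).
  rewrite ltNge; apply/negP => nua.
  have : C a by split => //; split => //; lra.
  by move/Ceta; lra.
have da : d ^+ 2 <= dot (z - a) (z - a).
  rewrite -sqr_enorm ler_pXn2r ?nnegrE ?enorm_ge0// ?(ltW d0)//.
  exact: dist_to_le.
(* Expanding, |z - a + t nu|^2 >= d^2 + 2 t s d + t^2 >= (d + s t)^2. *)
rewrite -(@ler_pXn2r _ 2) ?nnegrE ?enorm_ge0//; last first.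
  by rewrite addr_ge0 ?mulr_ge0// ltW.
rewrite sqr_enorm addrAC; move: da nua; move: (z - a) => u da nua.
rewrite dotDl !dotDr !dotZl !dotZr nu1 [dot _ nu]dotC.
have : t * (s * d) <= t * dot nu u by rewrite ler_pM2l// ltW.
have : (s * t) ^+ 2 <= t ^+ 2.
  by rewrite ler_pXn2r ?nnegrE ?mulr_ge0// ltW.
lra.
Qed.

(** If the best gain on the ball were below [h], subtracting a cone of slope [s], strictly between
    the average gain and 1, would leave a function with a maximum inside the ball, which
    [dist_to_ascent] forbids. *)
Lemma dist_to_climb y (h : R) : 0 < dist_to E y -> 0 <= h ->
  dist_to E y + h < r ->
  exists z, enorm (z - y) <= h /\ dist_to E y + h <= dist_to E z.
Proof.
move=> d0 h0 dhr; set d := dist_to E y in d0 dhr *.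
pose B := [set z | enorm (z - y) <= h].
have By : B y by rewrite /B /= subrr enorm0.
have cB : compact B.
  apply: (@compact_enorm _ _ _ y h) => //.
  apply/closed_enormP => x xB; apply/ler_addgt0Pl => e e0.
  have [z zy xz] := xB e e0; rewrite /B /= in zy.
  have := enorm_triangle z x y; rewrite (enormBC x z); lra.
have B0 : B !=set0 by exists y.
have [zM] := compact_EVT_max B0 cB (continuous_subspaceT dist_to_continuous).
rewrite inE => zMB zMmax.
exists zM; split => //; rewrite leNgt; apply/negP => zMd.
have dzM : d <= dist_to E zM by apply: zMmax; rewrite inE.
have h0' : 0 < h by lra.
pose q := (dist_to E zM - d) / h.
have qh : q * h = dist_to E zM - d by rewrite /q divfK// gt_eqF.
have q0 : 0 <= q by rewrite divr_ge0//; lra.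
have q1 : q < 1 by rewrite ltr_pdivrMr//; lra.
(* [q < 1] is the average slope reached by the maximum [zM]; [s] is midway between [q] and 1. *)
pose s := (1 + q) / 2.
have cg : continuous (fun z : 'rV[R]_n => dist_to E z - s * enorm (z - y)).
  move=> x; apply: (@continuousB _ _ _ (dist_to E)); first exact: dist_to_continuous.
  apply: (@continuousM _ _ (fun=> s)); first exact: cst_continuous.
  exact: enormB_continuous.
have [z] := compact_EVT_max B0 cB (continuous_subspaceT cg).
rewrite inE => zB zmax; rewrite /B /= in zB.
have := zmax y; rewrite inE subrr enorm0 mulr0 subr0 -/d => /(_ By) dz.
have zy0 := enorm_ge0 (z - y).
have s01 : 0 < s < 1 by rewrite /s; lra.
have dzr : 0 < dist_to E z < r.
  have := dist_to_lipschitz z y; rewrite -/d => ?.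
  apply/andP; split; last lra.
  have : 0 <= s * enorm (z - y) by apply: mulr_ge0 => //; lra.
  lra.
(* On the sphere the distance would be at least [d + s * h], more than its maximum [d + q * h]. *)
have zh : enorm (z - y) < h.
  rewrite lt_neqAle zB andbT; apply/eqP => zh.
  have := zMmax z; rewrite inE => /(_ zB); rewrite zh in dz.
  have : s * h = (h + (dist_to E zM - d)) / 2 by rewrite -qh /s; lra.
  lra.
(* The slope [(1 + s) / 2] exceeds [s], so a short ascent that stays in the ball increases the
   penalised function. *)
have [|t0 t0_gt0 tE] := @dist_to_ascent z ((1 + s) / 2) dzr; first by lra.
pose t := Num.min (t0 / 2) (h - enorm (z - y)).
have tp : 0 < t by rewrite lt_min; lra.
have [|z' [zz' dz']] := tE t.
  by rewrite tp /= (@le_lt_trans _ _ (t0 / 2)) ?ge_min ?lexx//; lra.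
have th : t <= h - enorm (z - y) by rewrite ge_min lexx orbT.
have z'y := enorm_triangle z z' y.
have := zmax z'; rewrite inE => /(_ (ltac:(rewrite /B /=; lra))).
have : s * enorm (z' - y) <= s * (t + enorm (z - y)).
  by apply: ler_wpM2l; lra.
have : s * t < t by rewrite gtr_pMl; lra.
lra.
Qed.

(* The point [z] of the previous lemma for [h = s - |y - p|] is forced to be
   [p + s (y - p) / |y - p|], so the ball [B(z, s)] touches [E] at [p] from
   outside. *)
Lemma normal_inequality y p a (s : R) : 0 < s < r -> E p -> E a ->
  dist_to E y = enorm (y - p) -> enorm (y - p) < s ->
  2 * s * dot (a - p) (y - p) <= enorm (a - p) ^+ 2 * enorm (y - p).
Proof.
move=> /andP[s0 sr] Ep Ea dy ds.
have [yp0|yp0] := eqVneq (y - p) 0.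
  by rewrite yp0 enorm0 mulr0 -(scale0r 0) dotZr mul0r mulr0.
set d := enorm (y - p) in dy ds *.
have d0 : 0 < d by rewrite enorm_gt0.
have [||| z [zy dz]] := @dist_to_climb y (s - d); rewrite ?dy//; [lra|lra|].
(* Equality case of the triangle inequality: |u| <= s - d, |v| = d and |u + v| >= s force [u] to
   point along [v]. *)
have colinear (u v : 'rV[R]_n) : dot v v = d ^+ 2 -> dot u u <= (s - d) ^+ 2 ->
    s ^+ 2 <= dot (u + v) (u + v) -> u = ((s - d) / d) *: v.
  move=> vE u2 zp.
  have uv : (s - d) * d <= dot u v.
    by move: zp; rewrite dotDl !dotDr vE (dotC v u); lra.
  apply/eqP; rewrite -subr_eq0 -enorm_eq0 -sqrf_eq0 sqr_enorm.
  rewrite eq_le dot_ge0 andbT.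
  rewrite dotDl !dotDr !dotNl !dotNr !dotZl !dotZr vE (dotC v u).
  set k := (s - d) / d.
  have kd : k * d = s - d by rewrite divfK// gt_eqF.
  have k0 : 0 <= k by rewrite divr_ge0; lra.
  have -> : k * (k * d ^+ 2) = (s - d) ^+ 2 by rewrite -kd; lra.
  have : k * ((s - d) * d) <= k * dot u v by apply: ler_wpM2l.
  have -> : k * ((s - d) * d) = (s - d) ^+ 2 by rewrite -kd; lra.
  lra.
have vE : dot (y - p) (y - p) = d ^+ 2 by rewrite -sqr_enorm.
have uE : z - y = ((s - d) / d) *: (y - p).
  apply: colinear => //.
    by rewrite -sqr_enorm ler_pXn2r ?nnegrE ?enorm_ge0//; lra.
  rewrite addrA subrK -sqr_enorm ler_pXn2r ?nnegrE ?enorm_ge0//; last lra.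
  by have := dist_to_le z Ep; lra.
(* No point of [E] lies in the open ball of radius [s] about [z]; expanding this around [p] gives
   the inequality. *)
have az : s ^+ 2 <= dot (z - a) (z - a).
  rewrite -sqr_enorm ler_pXn2r ?nnegrE ?enorm_ge0//; last lra.
  by have := dist_to_le z Ea; lra.
have zaE : z - a = (s / d) *: (y - p) - (a - p).
  have -> : s / d = (s - d) / d + 1 by rewrite mulrBl divff ?gt_eqF// subrK.
  by rewrite scalerDl -uE scale1r addrA subrK opprB addrA subrK.
move: az; rewrite zaE; move: (y - p) (a - p) vE => v w vE.
rewrite dotDl !dotDr !dotNl !dotNr !dotZl !dotZr vE (dotC v) -[dot w w]sqr_enorm.
set k := s / d; have kd : k * d = s by rewrite divfK// gt_eqF.
have -> : k * (k * d ^+ 2) = s ^+ 2 by rewrite -kd; lra.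
move=> az.
have az' : 2 * k * dot w v <= enorm w ^+ 2 by lra.
have := ler_wpM2r (ltW d0) az'.
by rewrite -{1}kd; lra.
Qed.

End tube.

(* Federer, Curvature measures, Theorem 4.8 (7), for points [y] close to [E]. *)
Definition proximal_at (x : 'rV[R]_n) (s c : R) := forall y, enorm (y - x) < s ->
  exists p, [/\ E p, enorm (y - p) <= enorm (y - x) &
    forall a, E a -> dot (a - p) (y - p) <= c * enorm (a - p) ^+ 2 * enorm (y - p)].

End distance.

(** For [r] below the reach, a point at distance less than [r] from [E] lies in a ball centred on
    [E], of radius above [r], that is contained in [Unp E]. *)
Lemma positive_reach_tube {R : realType} {n : nat} (E : set 'rV[R]_n) :
  E !=set0 -> positive_reach E ->
  exists2 r : R, 0 < r & forall y, dist_to E y < r -> Unp E y.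
Proof.
move=> E0; rewrite /positive_reach => rE.
have [r r0 rE'] : exists2 r : R, 0 < r & (r%:E < reach E)%E.
  move: rE; case: (reach E) => [x|_|//].
    by rewrite lte_fin => x0; exists (x / 2); rewrite ?lte_fin; lra.
  by exists 1; rewrite ?ltry.
exists r => // y dy.
have [a Ea ya] : exists2 a, E a & enorm (y - a) < r.
  apply: contrapT => na; move: dy; apply/negP; rewrite -leNgt le_dist_to// => a Ea.
  by rewrite leNgt; apply/negP => ya; apply: na; exists a.
have : (r%:E < reach_at E a)%E.
  by apply: lt_le_trans rE' _; apply: ereal_inf_lbound; exists a.
rewrite /reach_at lt_max => /orP[|].
  by rewrite lte_fin ltNge (ltW r0).
move=> /ereal_sup_gt[_ [r' [r'0 aE] <-]]; rewrite lte_fin => rr'.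
by apply: aE; rewrite /eball/= (lt_trans _ rr').
Qed.

Lemma positive_reach_proximal {R : realType} {n : nat} (E : set 'rV[R]_n) :
  E !=set0 -> positive_reach E -> closed E /\
  exists s c : R, [/\ 0 < s, 0 < c & forall x, E x -> proximal_at E x s c].
Proof.
move=> E0 /(positive_reach_tube E0)[r r0 rE]; split; first exact: unp_closed rE r0.
have r20 : 0 < r / 2 by lra.
(* With touching radius [r / 2], the factor [2 * s] of [normal_inequality] is [r], whence the
   constant [r^-1]. *)
exists (r / 2), r^-1; split => //; first by rewrite invr_gt0.
move=> x Ex y yx.
have dyx := dist_to_le y Ex.
have [|p [[Ep pd] _]] := rE y; first lra.
exists p; split => //; first by rewrite -enormBC -pd.
move=> a Ea.
rewrite -(ler_pM2l r0) !mulrA divff ?gt_eqF// mul1r.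
have := @normal_inequality _ _ E E0 r rE r0 y p a (r / 2).
rewrite mulrCA divff ?pnatr_eq0// mulr1; apply => //.
- by lra.
- by rewrite -enormBC.
- by rewrite -enormBC -pd; lra.
Qed.

(** * Tangent vectors *)

Section tangent.
Context {R : realType} {n : nat} (E : set 'rV[R]_n) (x0 : 'rV[R]_n).
Implicit Types (v w p a b : 'rV[R]_n).

(** The adjacent (Ursescu) cone: the distance from [x0 + rho *: w] to [E] is o(rho) along all small
    scales. *)
Definition adjacent_cone : set 'rV[R]_n := [set w | forall e : R, 0 < e ->
  \forall rho \near 0^'+,
    exists2 a, E a & enorm (x0 + rho *: w - a) <= e * rho].

(** The contingent (Bouligand) cone: the same approximation, only at arbitrarily small scales. *)
Definition contingent_cone : set 'rV[R]_n := [set w | forall e d : R,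
  0 < e -> 0 < d -> exists rho a,
    [/\ 0 < rho < d, E a & enorm (x0 + rho *: w - a) <= e * rho]].

Lemma adjacent_contingent : adjacent_cone `<=` contingent_cone.
Proof.
move=> w wE e d e0 d0; near (0 : R)^'+ => rho.
have [|a Ea xa] := near (wE e e0) rho; first by [].
exists rho, a; split => //; apply/andP; split.
  by near: rho; exact: nbhs_right_gt.
by near: rho; exact: nbhs_right_lt.
Unshelve. all: by end_near. Qed.

(** If the points [x0 + rho *: w] meet [E] at arbitrarily small scales, they are approximations with
    error 0. The contrapositive handles vectors outside the cone. *)
Lemma contingent_blowup w :
  ~ (\forall rho \near 0^'+, ~ E (x0 + rho *: w)) -> contingent_cone w.
Proof.
move=> nE e d e0 d0; apply: contrapT => nw; apply: nE; near=> rho => Ew.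
have rho0 : 0 < rho by near: rho; exact: nbhs_right_gt.
apply: nw; exists rho, (x0 + rho *: w); split => //.
  by rewrite rho0 /=; near: rho; exact: nbhs_right_lt.
by rewrite subrr enorm0 mulr_ge0// ltW.
Unshelve. all: by end_near. Qed.

Lemma adjacent_closed : closed adjacent_cone.
Proof.
apply/closed_enormP => w wE e e0.
have e20 : 0 < e / 2 by lra.
have [w' w'E ww'] := wE _ e20.
near=> rho.
have rho0 : 0 < rho by near: rho; exact: nbhs_right_gt.
have [|a Ea xa] := near (w'E _ e20) rho; first by [].
exists a => //.
have -> : x0 + rho *: w - a = (x0 + rho *: w' - a) - rho *: (w' - w).
  by apply/rowP => i; rewrite !mxE; lra.
rewrite (le_trans (enormD _ _))// enormN enormZ gtr0_norm//.
have : rho * enorm (w' - w) <= rho * (e / 2) by rewrite ler_pM2l// ltW.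
lra.
Unshelve. all: by end_near. Qed.

(** Choosing [y] for [d = 1 / (k + 1)] produces the sequence that [tangent_cone] asks for. *)
Lemma limit_point_direction v :
  (forall d : R, 0 < d -> exists y, [/\ E y, y <> x0, enorm (y - x0) < d &
     enorm ((enorm (y - x0))^-1 *: (y - x0) - v) < d]) ->
  limit_point E x0 /\ forall l : R, 0 <= l -> tangent_cone E x0 (l *: v).
Proof.
move=> Ev; have lpE : limit_point E x0.
  move=> U /nbhs_enormP[e e0 xU]; have [y [Ey yx0 yx _]] := Ev e e0.
  by exists y; split => //; [exact/eqP|exact: xU].
split => // l l0; left; split => //.
have invn k : 0 < k.+1%:R^-1 :> R by rewrite invr_gt0.
have /choice[u uP] := fun k => Ev _ (invn k).
exists l, v, u; split => //.
- by move=> h; have [] := uP h.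
- by apply: cvg_enorm => h; have [] := uP h.
- by apply: cvg_enorm => h; have [] := uP h.
Qed.

(** Even for the factor 0, [tangent_cone] demands a limit direction; compactness of the unit ball
    supplies one. *)
Lemma limit_point_tangent0 : limit_point E x0 -> tangent_cone E x0 0.
Proof.
move=> lpE.
have invn k : 0 < k.+1%:R^-1 :> R by rewrite invr_gt0.
have /choice[u uP] : forall k : nat, exists y,
    [/\ E y, y <> x0 & enorm (y - x0) < k.+1%:R^-1].
  move=> k; have [|y [/eqP yx0 Ey xy]] := lpE (eball x0 k.+1%:R^-1).
    by apply/nbhs_enormP; exists k.+1%:R^-1.
  by exists y.
pose f k := (enorm (u k - x0))^-1 *: (u k - x0).
have f1 k : enorm (f k) = 1.
  have [_ ux0 _] := uP k.
  rewrite enormZ ger0_norm ?invr_ge0 ?enorm_ge0// mulVf// enorm_eq0 subr_eq0.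
  exact/eqP.
pose S : set 'rV[R]_n := [set z | enorm z <= 1].
have cS : compact S.
  apply: (@compact_enorm _ _ _ 0 1); last by move=> y; rewrite subr0.
  apply/closed_enormP => x xS; apply/ler_addgt0Pl => e e0.
  have [y yS xy] := xS e e0; rewrite /S /= in yS.
  have := enormD (x - y) y; rewrite subrK enormBC; lra.
have [|v [_ clv]] := cS (f @ \oo) _.
  by exists 0%N => // k _; rewrite /S /= f1.
have [|_ /(_ 0 (lexx _))] := @limit_point_direction v; last by rewrite scale0r.
move=> d d0.
have [||z [[k [kd ->]] vz]] :=
  clv [set z | exists k, k.+1%:R^-1 < d /\ z = f k] (eball v d).
- by apply: filterS (near_infty_natSinv_lt (PosNum d0)) => k kd; exists k.
- by apply/nbhs_enormP; exists d.
have [Eu ux0 uk] := uP k.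
by exists (u k); split => //; exact: lt_trans kd.
Qed.

Lemma tangent_contingent : E x0 -> tangent_cone E x0 `<=` contingent_cone.
Proof.
move=> Ex0; have C0 : contingent_cone 0.
  move=> e d e0 d0; exists (d / 2), x0; split; [lra|by []|].
  by rewrite scaler0 addr0 subrr enorm0 mulr_ge0; lra.
move=> w [[_ [l [v [u [l0 -> uE ux0 uv]]]]]|[_ ->]]; last exact: C0.
have [->|l0'] := eqVneq l 0; first by rewrite scale0r.
have lp : 0 < l by rewrite lt_def l0'.
move=> e d e0 d0.
have near1 : \forall h \near \oo, enorm (u h - x0) < d * l.
  by apply: (ux0 (eball x0 (d * l)));
    apply/nbhs_enormP; exists (d * l); rewrite ?mulr_gt0.
have near2 : \forall h \near \oo,
    enorm ((enorm (u h - x0))^-1 *: (u h - x0) - v) < e / l.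
  by apply: (uv (eball v (e / l)));
    apply/nbhs_enormP; exists (e / l); rewrite ?divr_gt0.
near \oo => h.
have h1 : enorm (u h - x0) < d * l by near: h.
have h2 : enorm ((enorm (u h - x0))^-1 *: (u h - x0) - v) < e / l by near: h.
have [Eu /eqP ux] := uE h.
have r0 : 0 < enorm (u h - x0) by rewrite enorm_gt0 subr_eq0.
(* At this scale [rho], the vector [rho *: w] is |u h - x0| v, which the convergence of directions
   compares with [u h - x0]. *)
exists (enorm (u h - x0) / l), (u h); split => //.
  by rewrite divr_gt0// ltr_pdivrMr.
set r := enorm (u h - x0) in r0 h1 h2 *.
have -> : x0 + (r / l) *: (l *: v) - u h = - (r *: (r^-1 *: (u h - x0) - v)).
  rewrite scalerA divfK// scalerBr scalerA divff ?gt_eqF// scale1r.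
  by rewrite opprB opprB addrCA addrA.
rewrite enormN enormZ gtr0_norm// mulrCA ler_pM2l// ltW.
Unshelve. all: by end_near. Qed.

(** The difference is [b - w] divided by |w| plus a multiple of [b] of norm ||w| - |b|| / |w|; each
    part has norm at most |b - w| / |w|. *)
Lemma direction_dist (w : 'rV[R]_n) (b : 'rV[R]_n) : w != 0 -> b != 0 ->
  enorm ((enorm b)^-1 *: b - (enorm w)^-1 *: w) <= 2 * enorm (b - w) / enorm w.
Proof.
rewrite -!enorm_gt0 => w0 b0.
have -> : (enorm b)^-1 *: b - (enorm w)^-1 *: w =
  (enorm w)^-1 *: (b - w) + ((enorm w - enorm b) / enorm w / enorm b) *: b.
  rewrite scalerBr addrAC -scalerDl; congr (_ *: b - _).
  rewrite !mulrBl divff ?gt_eqF// mul1r.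
  by rewrite -[_ / _ / _]mulrAC divff ?gt_eqF// mul1r addrC subrK.
rewrite (le_trans (enormD _ _))// !enormZ.
rewrite normrM (gtr0_norm (x := (enorm b)^-1)) ?invr_gt0// divfK ?gt_eqF//.
rewrite normrM (gtr0_norm (x := (enorm w)^-1)) ?invr_gt0//.
have bw : `|enorm w - enorm b| <= enorm (b - w).
  have h1 := enormD (b - w) w; have h2 := enormD (w - b) b.
  rewrite !subrK (enormBC w b) in h1 h2.
  by rewrite ler_norml lerBlDr lerNl opprB lerBlDr h1 h2.
have := ler_wpM2r (_ : 0 <= (enorm w)^-1) bw; rewrite invr_ge0 ltW// => /(_ isT).
lra.
Qed.

Lemma adjacent_tangent : E x0 -> adjacent_cone `<=` tangent_cone E x0.
Proof.
move=> Ex0 w wE.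
have : closure E x0 by exact: subset_closure.
rewrite closure_isolated_limit_point => -[isoE|lpE].
  right; split => //; apply/eqP; rewrite -enorm_eq0 eq_le enorm_ge0 andbT leNgt.
  (* A nonzero [w] would give points of [E] within half of |rho w| of [x0 + rho *: w]: these differ
     from [x0] yet approach it. *)
  apply/negP => w0.
  have [_ [V /nbhs_enormP[e e0 xV] VE]] := isoE.
  have w20 : 0 < enorm w / 2 by lra.
  near (0 : R)^'+ => rho.
  have rho0 : 0 < rho by near: rho; exact: nbhs_right_gt.
  have [|a Ea xa] := near (wE _ w20) rho; first by [].
  have rhoe : rho < e / (2 * enorm w).
    by near: rho; apply: nbhs_right_lt; rewrite divr_gt0// mulr_gt0.
  move: rhoe; rewrite ltr_pdivlMr ?mulr_gt0// => rhoe.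
  have rw : enorm (rho *: w) = rho * enorm w by rewrite enormZ gtr0_norm.
  have ax0 : a = x0.
    suff : (V `&` E) a by rewrite VE.
    split => //; apply: xV; rewrite /eball /= enormBC.
    have -> : x0 - a = (x0 + rho *: w - a) + (- (rho *: w)) by rewrite addrAC addrK.
    rewrite (le_lt_trans (enormD _ _))// enormN rw.
    have : 0 < rho * enorm w by exact: mulr_gt0.
    lra.
  move: xa; rewrite ax0 addrAC subrr add0r rw.
  have : 0 < rho * enorm w by exact: mulr_gt0.
  lra.
have [->|w0] := eqVneq w 0; first exact: limit_point_tangent0.
have w0' : 0 < enorm w by rewrite enorm_gt0.
rewrite -[w](@scalerKV _ _ (enorm w)) ?gt_eqF//.
apply: (limit_point_direction _).2; last exact: enorm_ge0.
move=> d d0.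
(* The first bound keeps [a] away from [x0]; the second, with the factor 2 of [direction_dist],
   brings the error of direction below [d]. *)
pose e := Num.min (enorm w / 2) (d * enorm w / 4).
have e0 : 0 < e by rewrite lt_min !divr_gt0// mulr_gt0.
have ew : e <= enorm w / 2 by rewrite ge_min lexx.
have ed : e <= d * enorm w / 4 by rewrite ge_min lexx orbT.
near (0 : R)^'+ => rho.
have rho0 : 0 < rho by near: rho; exact: nbhs_right_gt.
have [|a Ea xa] := near (wE _ e0) rho; first by [].
have rhoe : rho < d / (2 * enorm w).
  by near: rho; apply: nbhs_right_lt; rewrite divr_gt0// mulr_gt0.
move: rhoe; rewrite ltr_pdivlMr ?mulr_gt0// => rhoe.
have rw : enorm (rho *: w) = rho * enorm w by rewrite enormZ gtr0_norm.
have rw0 : 0 < rho * enorm w by exact: mulr_gt0.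
have axE : enorm ((a - x0) - rho *: w) <= e * rho.
  by rewrite -addrA -opprD enormBC.
have er : e * rho <= rho * enorm w / 2.
  by rewrite mulrC -mulrA ler_pM2l.
have ax0 : a - x0 != 0.
  apply/eqP => ax0; move: axE; rewrite ax0 sub0r enormN rw; lra.
exists a; split => //.
- by move=> aE; move: ax0; rewrite aE subrr eqxx.
- have := enormD ((a - x0) - rho *: w) (rho *: w); rewrite subrK rw; lra.
have -> : (enorm w)^-1 *: w = (enorm (rho *: w))^-1 *: (rho *: w).
  by rewrite rw scalerA invfM mulrC mulrA divff ?gt_eqF// mul1r.
apply: le_lt_trans (direction_dist _ ax0) _.
  by rewrite -enorm_gt0 rw.
rewrite ltr_pdivrMr rw//.
have : e * rho <= d * enorm w / 4 * rho by rewrite ler_pM2r.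
have : 0 < d * (rho * enorm w) by exact: mulr_gt0.
lra.
Unshelve. all: by end_near. Qed.

End tangent.

(** * Tangent vectors at a point of a proximally smooth set *)

Section proximal.
Context {R : realType} {n : nat} (E : set 'rV[R]_n) (x0 : 'rV[R]_n) (s c : R).
Hypotheses (Ex0 : E x0) (s0 : 0 < s) (c0 : 0 < c) (Eprox : proximal_at E x0 s c).
Implicit Types (v w p a b : 'rV[R]_n).

(** As [m - p] is the convex combination of [a - p] and [b - p], |m - p|^2 is that of their products
    with [m - p]. The proximal inequality bounds both products, and one factor |m - p| cancels. *)
Lemma convex_combination_near a b (t : R) : E a -> E b -> 0 <= t <= 1 ->
  enorm (a + t *: (b - a) - x0) < s -> exists p, [/\ E p,
    enorm (a + t *: (b - a) - p) <= enorm (a + t *: (b - a) - x0) &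
    enorm (a + t *: (b - a) - p) <=
      c * ((1 - t) * enorm (a - p) ^+ 2 + t * enorm (b - p) ^+ 2)].
Proof.
move=> Ea Eb /andP[t0 t1]; set m := a + t *: (b - a).
move=> /Eprox[p [Ep mp pE]]; exists p; split => //.
have mpE : m - p = (1 - t) *: (a - p) + t *: (b - p).
  by apply/rowP => i; rewrite !mxE; lra.
have := sqr_enorm (m - p); rewrite {2}mpE dotDl !dotZl.
move: (pE _ Ea) (pE _ Eb).
move: (dot (a - p) _) (dot (b - p) _) => da db ha hb dE.
have ha' := ler_wpM2l (_ : 0 <= 1 - t) ha.
have hb' := ler_wpM2l t0 hb.
have [->|mp0] := eqVneq (enorm (m - p)) 0.
  by rewrite mulr_ge0 ?(ltW c0)// addr_ge0// mulr_ge0 ?sqr_ge0//; lra.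
rewrite -(ler_pM2r (x := enorm (m - p))); last by rewrite lt_def mp0 enorm_ge0.
rewrite -expr2 dE; have := ha' (ltac:(lra)); lra.
Qed.

(* If [b] approximates [x0 + r w], the points of the segment [[x0, b]] are at
   distance [O(rho r)] from [E], where [rho] is the distance to [x0] in units
   of [w]: one good scale [r] controls all smaller scales [rho]. *)
Lemma contingent_adjacent : contingent_cone E x0 `<=` adjacent_cone E x0.
Proof.
move=> w wE e e0.
pose L := enorm w + 1; have L1 : 1 <= L by rewrite lerDr enorm_ge0.
have L0 : 0 < L by lra.
pose e' := Num.min (e / 2) 1.
have e'0 : 0 < e' by rewrite lt_min; lra.
have e'e : e' <= e / 2 by rewrite ge_min lexx.
have e'1 : e' <= 1 by rewrite ge_min lexx orbT.
have M0 : 0 < 26 * (c * L ^+ 2) by rewrite !mulr_gt0 ?exprn_gt0.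
(* The first bound keeps the segment where [Eprox] applies. The second makes the quadratic error at
   most [e / 2 * rho]: the 26 is twice 4 + 9, from the bounds on |x0 - p| and |b - p|. *)
pose d := Num.min (s / L) (e / (26 * (c * L ^+ 2))).
have d0 : 0 < d by rewrite lt_min !divr_gt0.
have [r [b [/andP[r0 rd] Eb bE]]] := wE e' d e'0 d0.
have rs : r * L < s.
  by rewrite -ltr_pdivlMr//; apply: lt_le_trans rd _; rewrite ge_min lexx.
have re : r * (26 * (c * L ^+ 2)) <= e.
  by rewrite -ler_pdivlMr//; apply: le_trans (ltW rd) _; rewrite ge_min lexx orbT.
near=> rho.
have rho0 : 0 < rho by near: rho; exact: nbhs_right_gt.
have rhor : rho < r by near: rho; exact: nbhs_right_lt.
pose t := rho / r.
have tr : t * r = rho by rewrite divfK// gt_eqF.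
have t0 : 0 < t by rewrite divr_gt0.
have t1 : t <= 1 by rewrite ler_pdivrMr// mul1r ltW.
have bx : enorm (b - x0) <= r * L.
  have -> : b - x0 = r *: w - (x0 + r *: w - b).
    by apply/rowP => i; rewrite !mxE; lra.
  rewrite (le_trans (enormD _ _))// enormN enormZ gtr0_norm//.
  have : e' * r <= 1 * r by rewrite ler_pM2r.
  rewrite /L; lra.
pose m := x0 + t *: (b - x0).
have mx : enorm (m - x0) <= rho * L.
  rewrite /m addrC addKr enormZ gtr0_norm// -tr -mulrA.
  by rewrite ler_pM2l.
have rhoL : rho * L <= r * L by rewrite ler_pM2r// ltW.
have [||p [Ep mpx mp]] := convex_combination_near Ex0 Eb (t := t).
- by rewrite t1 ltW.
- by rewrite -/m; lra.
exists p => //; rewrite -/m in mpx mp.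
have -> : x0 + rho *: w - p = t *: (x0 + r *: w - b) + (m - p).
  by apply/rowP => i; rewrite !mxE -tr; lra.
rewrite (le_trans (enormD _ _))// enormZ gtr0_norm//.
have h1 : t * enorm (x0 + r *: w - b) <= e / 2 * rho.
  apply: (@le_trans _ _ (t * (e' * r))); first by rewrite ler_pM2l.
  by rewrite mulrCA tr ler_pM2r.
have xp : enorm (x0 - p) <= 2 * (rho * L).
  have := enorm_triangle m x0 p; rewrite (enormBC x0 m); lra.
have bp : enorm (b - p) <= 3 * (r * L).
  have := enorm_triangle x0 b p; lra.
have rL0 : 0 <= rho * L by rewrite ltW// mulr_gt0.
have xp2 : enorm (x0 - p) ^+ 2 <= 4 * (rho * r * L ^+ 2).
  apply: (@le_trans _ _ ((2 * (rho * L)) ^+ 2)).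
    by rewrite ler_pXn2r ?nnegrE ?enorm_ge0//; lra.
  have : rho * L * (rho * L) <= rho * L * (r * L) by rewrite ler_wpM2l.
  lra.
have bp2 : t * enorm (b - p) ^+ 2 <= 9 * (rho * r * L ^+ 2).
  apply: (@le_trans _ _ (t * (3 * (r * L)) ^+ 2)).
    by rewrite ler_pM2l// ler_pXn2r ?nnegrE ?enorm_ge0//; lra.
  by rewrite -tr; lra.
have xp3 : (1 - t) * enorm (x0 - p) ^+ 2 <= enorm (x0 - p) ^+ 2.
  by rewrite ler_piMl ?sqr_ge0//; lra.
have : c * ((1 - t) * enorm (x0 - p) ^+ 2 + t * enorm (b - p) ^+ 2) <=
    c * (13 * (rho * r * L ^+ 2)) by rewrite ler_pM2l//; lra.
have := ler_wpM2r (ltW rho0) re.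
lra.
Unshelve. all: by end_near. Qed.

Lemma adjacent0 : adjacent_cone E x0 0.
Proof.
move=> e e0; near=> rho; exists x0 => //.
by rewrite scaler0 addr0 subrr enorm0 mulr_ge0 ?(ltW e0).
Unshelve. all: by end_near. Qed.

(** By [contingent_adjacent] arbitrarily small scales suffice: a point good for [w] at scale [rho]
    is good for [l *: w] at scale [rho / l]. *)
Lemma adjacentZ (l : R) w : 0 <= l ->
  adjacent_cone E x0 w -> adjacent_cone E x0 (l *: w).
Proof.
rewrite le_eqVlt => /predU1P[<- _|l0 wE]; first by rewrite scale0r; exact: adjacent0.
apply: contingent_adjacent => e d e0 d0.
have [rho [a [/andP[rho0 rhod] Ea aE]]] := adjacent_contingent wE
  (divr_gt0 e0 l0) (mulr_gt0 d0 l0).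
exists (rho / l), a; split => //.
  by rewrite divr_gt0//= ltr_pdivrMr.
by rewrite scalerA divfK ?gt_eqF// mulrCA [leRHS]mulrC.
Qed.

(** The midpoint of approximations for [w1] and [w2] at scale [r] approximates the sum at scale
    [r / 2], and lies within O(r^2) of [E]. *)
Lemma adjacentD w1 w2 : adjacent_cone E x0 w1 -> adjacent_cone E x0 w2 ->
  adjacent_cone E x0 (w1 + w2).
Proof.
move=> w1E w2E; apply: contingent_adjacent => e d e0 d0.
pose K := enorm w1 + enorm w2 + 2.
have K2 : 2 <= K by rewrite /K; have := enorm_ge0 w1; have := enorm_ge0 w2; lra.
have K0 : 0 < K by lra.
pose e' := Num.min (e / 4) 1.
have e'0 : 0 < e' by rewrite lt_min; lra.
have e'e : e' <= e / 4 by rewrite ge_min lexx.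
have e'1 : e' <= 1 by rewrite ge_min lexx orbT.
(* Since [p] is within [2 * r * K] of both ends, the factor 16 bounds the quadratic error by
   [e / 4 * r]; with the equal error of the ends this is [e * (r / 2)]. *)
have M0 : 0 < 16 * (c * K ^+ 2) by rewrite !mulr_gt0 ?exprn_gt0.
near (0 : R)^'+ => r.
have r0 : 0 < r by near: r; exact: nbhs_right_gt.
have [|a aE1 aE] := near (w1E _ e'0) r; first by [].
have [|b bE1 bE] := near (w2E _ e'0) r; first by [].
have rd : r < d by near: r; exact: nbhs_right_lt.
have rs : r * K < s.
  by rewrite -ltr_pdivlMr//; near: r; apply: nbhs_right_lt; rewrite divr_gt0.
have re : r * (16 * (c * K ^+ 2)) < e.
  by rewrite -ltr_pdivlMr//; near: r; apply: nbhs_right_lt; rewrite divr_gt0.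
have e'r : e' * r <= 1 * r by rewrite ler_pM2r.
have bound w z : enorm (x0 + r *: w - z) <= e' * r ->
    enorm (z - x0) <= r * (enorm w + 1).
  move=> zE; have -> : z - x0 = r *: w - (x0 + r *: w - z).
    by apply/rowP => i; rewrite !mxE; lra.
  rewrite (le_trans (enormD _ _))// enormN enormZ gtr0_norm//; lra.
have ax := bound _ _ aE; have bx := bound _ _ bE.
pose m := a + 2^-1 *: (b - a).
have mx : enorm (m - x0) <= r / 2 * K.
  have -> : m - x0 = 2^-1 *: ((a - x0) + (b - x0)).
    by apply/rowP => i; rewrite !mxE; lra.
  rewrite enormZ gtr0_norm//; have := enormD (a - x0) (b - x0).
  rewrite /K; lra.
have rK0 : 0 < r * K by exact: mulr_gt0.
have [||p [Ep mpx mp]] := convex_combination_near aE1 bE1 (t := 2^-1).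
- by lra.
- by rewrite -/m; lra.
rewrite -/m in mpx mp.
exists (r / 2), p; split => //; first by apply/andP; split; lra.
have -> : x0 + (r / 2) *: (w1 + w2) - p =
    2^-1 *: ((x0 + r *: w1 - a) + (x0 + r *: w2 - b)) + (m - p).
  by apply/rowP => i; rewrite !mxE; lra.
rewrite (le_trans (enormD _ _))// enormZ gtr0_norm//.
have h1 := enormD (x0 + r *: w1 - a) (x0 + r *: w2 - b).
have h1' : e' * r <= e / 4 * r by rewrite ler_pM2r.
have xp := enorm_triangle m x0 p; rewrite (enormBC x0 m) in xp.
have bp z : enorm (z - x0) <= r * K -> enorm (z - p) ^+ 2 <= 4 * (r * K) ^+ 2.
  move=> zx; apply: (@le_trans _ _ ((2 * (r * K)) ^+ 2)); last lra.
  rewrite ler_pXn2r ?nnegrE ?enorm_ge0//; last lra.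
  by have := enorm_triangle x0 z p; lra.
have w10 := mulr_ge0 (ltW r0) (enorm_ge0 w1).
have w20 := mulr_ge0 (ltW r0) (enorm_ge0 w2).
have [] := (bp a (ltac:(rewrite /K; lra)), bp b (ltac:(rewrite /K; lra))).
move=> ap2 bp2.
have : c * ((1 - 2^-1) * enorm (a - p) ^+ 2 + 2^-1 * enorm (b - p) ^+ 2) <=
  c * (4 * (r * K) ^+ 2) by rewrite ler_pM2l//; lra.
have := ler_wpM2l (ltW r0) (ltW re).
lra.
Unshelve. all: by end_near. Qed.

(** Let [p] be the proximal point of [y = x0 + rho *: w]. Points of [E] near [y] shifted by [rho]
    along each signed axis bound every coordinate of [y - p] by a small multiple of |y - p|, which
    forces [y = p]. *)
Lemma adjacent_interior w :
  (forall i, adjacent_cone E x0 (w + delta_mx 0 i) /\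
             adjacent_cone E x0 (w - delta_mx 0 i)) ->
  \forall rho \near 0^'+, E (x0 + rho *: w).
Proof.
move=> wE.
(* Chosen so that [n * (2 * e) < 1], where [n] is the constant of [enorm_le_norm]. *)
pose e : R := (2 * n.+1%:R)^-1.
have n1 : 0 < n.+1%:R :> R by [].
have e0 : 0 < e by rewrite invr_gt0 mulr_gt0.
have en : 2 * (n.+1%:R * e) = 1 by rewrite mulrA mulfV ?gt_eqF ?mulr_gt0.
have e1 : e <= 1.
  by rewrite invf_le1 ?mulr_gt0// -natrM ler1n.
pose K := enorm w + 2.
have K0 : 0 < K by rewrite /K; have := enorm_ge0 w; lra.
have [wE1 wE2] := all_and2 wE.
near=> rho.
have rho0 : 0 < rho by near: rho; exact: nbhs_right_gt.
have aP : forall i, exists2 a, E a &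
    enorm (x0 + rho *: (w + delta_mx 0 i) - a) <= e * rho.
  by near: rho; apply: filter_forall => i; exact: wE1.
have bP : forall i, exists2 a, E a &
    enorm (x0 + rho *: (w - delta_mx 0 i) - a) <= e * rho.
  by near: rho; apply: filter_forall => i; exact: wE2.
have rs : rho * K < s.
  by rewrite -ltr_pdivlMr//; near: rho; apply: nbhs_right_lt; rewrite divr_gt0.
have re : rho * (c * K ^+ 2) < e.
  rewrite -ltr_pdivlMr ?mulr_gt0 ?exprn_gt0//.
  by near: rho; apply: nbhs_right_lt; rewrite !divr_gt0// ?mulr_gt0// exprn_gt0.
have yx : enorm (x0 + rho *: w - x0) = rho * enorm w.
  by rewrite addrC addKr enormZ gtr0_norm.
have [|p [Ep yp pE]] := Eprox (y := x0 + rho *: w).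
  by rewrite yx; move: rs; rewrite /K; have := mulr_ge0 (ltW rho0) (enorm_ge0 w); lra.
rewrite yx in yp.
set y := x0 + rho *: w in yx yp pE *.
set d := enorm (y - p) in yp pE.
have d0 : 0 <= d := enorm_ge0 _.
(* In the proximal inequality for [a], the square [d ^+ 2] is dropped; the approximation error and
   the quadratic term each cost [e * rho * d]. *)
have key f a : enorm f = 1 -> E a ->
    enorm (x0 + rho *: (w + f) - a) <= e * rho -> dot f (y - p) <= 2 * e * d.
  move=> f1 Ea aE; have := pE a Ea.
  have apE : a - p = (y - p) + rho *: f - (x0 + rho *: (w + f) - a).
    by apply/rowP => i; rewrite !mxE; lra.
  have ap : enorm (a - p) <= rho * K.
    rewrite apE (le_trans (enormD _ _))// enormN.
    have := enormD (y - p) (rho *: f); rewrite enormZ gtr0_norm// f1 -/d.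
    have : e * rho <= 1 * rho by rewrite ler_pM2r.
    by rewrite /K; lra.
  have cs := cauchy_schwarz (x0 + rho *: (w + f) - a) (y - p); rewrite -/d in cs.
  have er : enorm (x0 + rho *: (w + f) - a) * d <= e * rho * d by rewrite ler_wpM2r.
  have apd : dot (a - p) (y - p) = d ^+ 2 + rho * dot f (y - p) -
      dot (x0 + rho *: (w + f) - a) (y - p).
    by rewrite {1}apE dotDl dotDl dotNl dotZl -sqr_enorm.
  have ap2 : c * enorm (a - p) ^+ 2 * d <= rho * e * d.
    rewrite ler_wpM2r//.
    apply: (@le_trans _ _ (c * (rho * K) ^+ 2)).
      by rewrite ler_pM2l// ler_pXn2r ?nnegrE ?enorm_ge0// ltW// mulr_gt0.
    by have := ler_wpM2l (ltW rho0) (ltW re); lra.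
  rewrite apd => h; rewrite -(ler_pM2l rho0).
  have := sqr_ge0 d; lra.
have delta1 i : enorm (delta_mx 0 i : 'rV[R]_n) = 1.
  apply/eqP; rewrite -(@eqrXn2 _ 2) ?enorm_ge0// sqr_enorm expr1n /dot.
  rewrite (bigD1 i)//= mxE !eqxx mulr1 big1 ?addr0// => j /negbTE ji.
  by rewrite mxE ji andbF mulr0.
have dotdelta i v : dot (delta_mx 0 i) v = v 0 i.
  rewrite /dot (bigD1 i)//= mxE !eqxx mul1r big1 ?addr0// => j /negbTE ji.
  by rewrite mxE ji andbF mul0r.
have ypd : `|y - p| <= 2 * e * d.
  rewrite [leLHS]/Num.norm /= mx_normrE; apply/bigmax_leP; split.
    by rewrite mulr_ge0// ltW// mulr_gt0.
  move=> [j i] _ /=; rewrite (ord1 j).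
  have [a Ea aE] := aP i; have [b Eb bE] := bP i.
  have := key _ _ (delta1 i) Ea aE.
  have := key (- delta_mx 0 i) _ _ Eb bE; rewrite enormN delta1 => /(_ erefl).
  rewrite dotNl !dotdelta ler_norml; lra.
have : d <= n%:R * (2 * e * d).
  by rewrite (le_trans (enorm_le_norm _))// ler_wpM2l.
have : n%:R = n.+1%:R - 1 :> R by rewrite -natr1 addrK.
move=> ->; rewrite mulrBl mul1r.
have -> : n.+1%:R * (2 * e * d) = d by have := congr1 (fun z => z * d) en; lra.
move=> dd; have : d = 0.
  apply/eqP; rewrite eq_le d0 andbT.
  by have e20 : 0 < 2 * e by [rewrite mulr_gt0]; rewrite -(pmulr_rle0 _ e20); lra.
by move/eqP; rewrite enorm_eq0 subr_eq0 => /eqP ->.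
Unshelve. all: by end_near. Qed.

End proximal.

(** * Convex cones and blow-ups *)

Lemma closed_affine_preimage {R : realType} {n : nat} (A : set 'rV[R]_n)
  (l : R) (v : 'rV[R]_n) : closed A -> closed [set w | A (l *: w + v)].
Proof.
move=> /closed_enormP cA; apply/closed_enormP => w wA; apply: cA => e e0.
have l0 : 0 < `|l| + 1 by rewrite ltr_wpDl.
have [y Ay yw] := wA _ (divr_gt0 e0 l0); exists (l *: y + v) => //.
rewrite opprD addrACA subrr addr0 -scalerBr enormZ.
move: yw; rewrite ltr_pdivlMr//; have := enorm_ge0 (y - w); lra.
Qed.

Lemma compact_measurable_Rn {R : realType} {n : nat} (K : set 'rV[R]_n) :
  compact K -> measurable (K : set (Rn R n)).
Proof.
move=> cK; apply: closed_measurable_Rn.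
exact: compact_closed (@norm_hausdorff _ 'rV[R]_n) cK.
Qed.

Section cone.
Context {R : realType} {n : nat} (T : set 'rV[R]_n).
Hypotheses (T0 : T 0) (cT : closed T).
Hypothesis TZ : forall (l : R) w, 0 <= l -> T w -> T (l *: w).
Hypothesis TD : forall v w, T v -> T w -> T (v + w).

(* For a convex cone these are the interior points of [T]. *)
Definition cone_interior : set 'rV[R]_n := [set w | exists k : nat, forall i,
  T (k.+1%:R *: w + delta_mx 0 i) /\ T (k.+1%:R *: w - delta_mx 0 i)].

(* Either [T - T] is the whole space, and [e] is an interior point of [T], or
   [e] is a vector outside [T - T]. *)
Lemma cone_interior_direction : exists e, forall x y (t : R),
  T x -> T y -> ~ cone_interior y -> 0 < t -> y <> x + t *: e.
Proof.
have [/choice[a /choice[b abE]]|] := pselect (forall i : 'I_n, exists a b,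
    [/\ T a, T b & delta_mx 0 i = a - b]).
  have Tsum (P : pred 'I_n) : T (\sum_(i | P i) (a i + b i)).
    by elim/big_ind : _ => // i _; have [? ? _] := abE i; exact: TD.
  (* [e] plus or minus a basis vector stays in [T], since a_i + b_i plus or minus (a_i - b_i) is 2
     a_i or 2 b_i. *)
  pose e := \sum_i (a i + b i).
  have eE i : T (e + delta_mx 0 i) /\ T (e - delta_mx 0 i).
    have [Ta Tb ->] := abE i; rewrite /e (bigD1 i)//=.
    move: (Tsum (fun j => j != i)); move: (\sum_(j | _) _) => w Tw.
    have -> : a i + b i + w + (a i - b i) = w + (a i + a i).
      by apply/rowP => j; rewrite !mxE; lra.
    have -> : a i + b i + w - (a i - b i) = w + (b i + b i).
      by apply/rowP => j; rewrite !mxE; lra.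
    by split; do ?apply: TD.
  have Te : T e := Tsum xpredT.
  clearbody e; exists e => x y t Tx Ty yI t0 yE; apply: yI.
  (* Once (k + 1) t >= 1, (k + 1) y is [e] plus an element of [T], hence inherits the room around
     [e]. *)
  pose k := Num.bound t^-1; exists k => i.
  have kt : 0 <= k.+1%:R * t - 1.
    rewrite subr_ge0 -ler_pdivrMr// mul1r ltW// (lt_trans (archi_boundP _))//.
      by rewrite invr_ge0 ltW.
    by rewrite ltr_nat.
  have Tw : T (k.+1%:R *: x + (k.+1%:R * t - 1) *: e).
    by apply: TD; apply: TZ => //; exact: Te.
  have [Te1 Te2] := eE i; split.
  - have -> : k.+1%:R *: y + delta_mx 0 i =
      k.+1%:R *: x + (k.+1%:R * t - 1) *: e + (e + delta_mx 0 i).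
      by rewrite yE; apply/rowP => j; rewrite !mxE; lra.
    exact: TD.
  - have -> : k.+1%:R *: y - delta_mx 0 i =
      k.+1%:R *: x + (k.+1%:R * t - 1) *: e + (e - delta_mx 0 i).
      by rewrite yE; apply/rowP => j; rewrite !mxE; lra.
    exact: TD.
move/existsNP => [i iT]; exists (delta_mx 0 i) => x y t Tx Ty _ t0 yE.
have t0' : 0 <= t^-1 by rewrite invr_ge0 ltW.
(* Two points of [T] differing by [t] times the basis vector would write it as a difference of
   elements of [T]. *)
apply: iT; exists (t^-1 *: y), (t^-1 *: x); split; [exact: TZ|exact: TZ|].
by rewrite yE -scalerBr addrC addKr scalerA mulVf ?gt_eqF// scale1r.
Qed.

(** A countable union, over the integer [k], of finite intersections of closed sets. *)
Lemma cone_interior_measurable : measurable (cone_interior : set (Rn R n)).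
Proof.
pose A (k : nat) i : set 'rV[R]_n :=
  [set w | T (k.+1%:R *: w + delta_mx 0 i)] `&`
  [set w | T (k.+1%:R *: w - delta_mx 0 i)].
have cA k v : closed [set w | T (k.+1%:R *: w + v)].
  exact: closed_affine_preimage.
rewrite (_ : cone_interior = \bigcup_k \bigcap_(i in [set: 'I_n]) A k i).
  apply: bigcupT_measurable => k; apply: fin_bigcap_measurable => // i _.
  by apply: measurableI; apply: closed_measurable_Rn; exact: cA.
apply/seteqP; split => w; first by move=> [k kw]; exists k => // i _; exact: kw.
by move=> [k _ kw]; exists k => i; exact: kw.
Qed.

Lemma cone_boundary_null (K : set 'rV[R]_n) : compact K ->
  Rn_lebesgue ((T `\` cone_interior) `&` K : set (Rn R n)) = 0%E.
Proof.
move=> cK; have [e eP] := cone_interior_direction.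
have [r rK] := compact_enorm_lt cK.
apply: (@null_of_disjoint_translates _ _ _ e r).
- apply: measurableI; last exact: compact_measurable_Rn.
  apply: measurableD; first exact: closed_measurable_Rn.
  exact: cone_interior_measurable.
- by move=> x [_ /rK].
- by move=> x y t [[Tx _] _] [[Ty yI] _]; exact: eP.
Qed.

End cone.

Section blowup.
Context {R : realType} {n : nat} (E : set 'rV[R]_n) (x0 : 'rV[R]_n).

Lemma blowupE (rho : R) : rho != 0 -> blowup E x0 rho = [set v | E (x0 + rho *: v)].
Proof.
move=> rho0; apply/seteqP; split => [_ [x Ex <-]|v Ev] /=.
  by rewrite scalerKV// addrC subrK.
by exists (x0 + rho *: v) => //; rewrite addrC addKr scalerK.
Qed.

Lemma blowup_closed (rho : R) : closed E -> rho != 0 -> closed (blowup E x0 rho).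
Proof.
move=> cE rho0; rewrite blowupE//; under eq_set do rewrite addrC.
exact: closed_affine_preimage.
Qed.

End blowup.

(** * Convergence of the blow-ups *)

Lemma closed_borel {T : topologicalType} (A : set T) : closed A -> borel A.
Proof.
move=> cA; have [_ HC _] := smallest_sigma_algebra [set: T] [set U : set T | open U].
rewrite /borel -[A]setCK -setTD; apply: HC.
by apply: sub_sigma_algebra; exact: closed_openC.
Qed.

Lemma near_at_right0_scale {R : realType} (P : R -> Prop) (l : R) : 0 < l ->
  (\forall rho \near 0^'+, P rho) -> \forall rho \near 0^'+, P (l * rho).
Proof.
move=> l0 [e /= e0 eP]; near=> rho.
have rho0 : 0 < rho by near: rho; exact: nbhs_right_gt.
apply: eP; last exact: mulr_gt0.
rewrite /= sub0r normrN gtr0_norm ?mulr_gt0// mulrC -ltr_pdivlMr//.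
by near: rho; apply: nbhs_right_lt; exact: divr_gt0.
Unshelve. all: by end_near. Qed.

Lemma indic_integrable {R : realType} {n : nat} (A K : set 'rV[R]_n) :
  measurable (A : set (Rn R n)) -> compact K ->
  (@Rn_lebesgue R n).-integrable K (EFin \o (\1_A : 'rV[R]_n -> R)).
Proof.
move=> mA cK; apply: measurable_bounded_integrable.
- exact: compact_measurable_Rn.
- by have [r rK] := compact_enorm_lt cK; exact: bounded_lebesgue_outer_lty rK.
- exact: measurable_indic.
- exists 1; split; first exact: num_real.
  move=> x x1 y _ /=; rewrite indicE ger0_norm// (le_trans _ (ltW x1))//.
  by case: (y \in A); rewrite ?ler01.
Qed.

Theorem corollary3p4 (R : realType) (n : nat) (n_ge2 : (2 <= n)%N)
    (E : set 'rV[R]_n) (reachE : positive_reach E)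
    (x0 : 'rV[R]_n) (bdx0 : boundary E x0) :
  locally_cvg_in_measure (blowup E x0) (tangent_cone E x0).
Proof.
have E0 : E !=set0.
  by have [a [Ea _]] := bdx0.1 setT filterT; exists a.
have [cE [s [c [s0 c0 Eprox]]]] := positive_reach_proximal E0 reachE.
have Ex0 : E x0 by apply: cE; exact: bdx0.1.
have {}Eprox := Eprox x0 Ex0.
pose T := adjacent_cone E x0.
have CT : contingent_cone E x0 `<=` T := contingent_adjacent Ex0 s0 c0 Eprox.
(* The tangent cone lies in the contingent cone, which lies in the adjacent cone, which lies in the
   tangent cone. *)
have -> : tangent_cone E x0 = T.
  apply/seteqP; split; last exact: adjacent_tangent.
  exact: subset_trans (tangent_contingent Ex0) CT.
have cT : closed T := @adjacent_closed _ _ _ _.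
have T0 : T 0 := adjacent0 Ex0.
have TZ : forall (l : R) w, 0 <= l -> T w -> T (l *: w) := adjacentZ Ex0 s0 c0 Eprox.
have TD : forall v w, T v -> T w -> T (v + w) := adjacentD Ex0 s0 c0 Eprox.
have mT : measurable (T : set (Rn R n)) by exact: closed_measurable_Rn.
have cB (rho : R) : 0 < rho -> closed (blowup E x0 rho).
  by move=> rho0; apply: blowup_closed => //; rewrite gt_eqF.
have mB (rho : R) : 0 < rho -> measurable (blowup E x0 rho : set (Rn R n)).
  by move=> /cB; exact: closed_measurable_Rn.
split=> [rho /cB|]; first exact: closed_borel.
split=> [rho rho0 K cK|K cK|K cK]; [exact: indic_integrable (mB _ rho0) cK|
  exact: indic_integrable|].
(* The limit is tested along sequences of scales, as dominated convergence requires. *)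
apply/(@cvge_at_rightP _ _ 0 0) => u [u0 ucvg].
have ucvg' : u @ \oo --> (0 : R)^'+.
  move=> P [e /= e0 eP].
  have ue : \forall k \near \oo, ball 0 e (u k).
    by apply: (ucvg (ball 0 e)); exact: nbhsx_ballx.
  by apply: filterS ue => k uk; apply: eP.
have mK : measurable (K : set (Rn R n)) by exact: compact_measurable_Rn.
have [] := @dominated_convergence _ (Rn R n) R (@Rn_lebesgue R n) K mK
  (fun k => EFin \o \1_(blowup E x0 (u k))) (EFin \o \1_T) (cst 1%E).
- by move=> k; apply/measurable_EFinP/measurable_indic/mB/u0.
- exact/measurable_EFinP/measurable_indic.
(* Pointwise convergence may fail only at points of [K] on the boundary of [T], a null set. *)
- exists ((T `\` cone_interior T) `&` K); split.
  + apply: measurableI => //; apply: measurableD => //.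
    exact: cone_interior_measurable.
  + exact: cone_boundary_null.
  apply: subsetCl => x nx Kx.
  have [Tx|nTx] := pselect (T x).
    have [k kx] : cone_interior T x by apply: contrapT => xI; apply: nx.
    have kV0 : 0 < k.+1%:R^-1 :> R by rewrite invr_gt0.
    (* [adjacent_interior] concerns the vector (k + 1) x; at scale [u m] / (k + 1) it reaches the
       point [x0 + u m *: x]. *)
    have xE : \forall m \near \oo, E (x0 + (k.+1%:R^-1 * u m) *: (k.+1%:R *: x)).
      exact: ucvg' (near_at_right0_scale kV0
        (adjacent_interior s0 c0 Eprox kx)).
    apply: cvg_near_cst; apply: filterS xE => m.
    rewrite scalerA mulrAC mulVf ?pnatr_eq0// mul1r => Ex.
    by rewrite /= !indicE !mem_set// blowupE ?gt_eqF.
  have xE : \forall m \near \oo, ~ E (x0 + u m *: x).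
    apply: (ucvg' (fun rho => ~ E (x0 + rho *: x))).
    by apply: contrapT => /contingent_blowup/CT.
  apply: cvg_near_cst; apply: filterS xE => m Ex.
  by rewrite /= !indicE !memNset// blowupE ?gt_eqF.
- have := indic_integrable (measurableT : measurable (setT : set (Rn R n))) cK.
  by rewrite indicT.
- apply: aeW => x k _; rewrite /= lee_fin indicE ger0_norm//.
  by case: (_ \in _).
by move=> _ + _; apply.
Qed.
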